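(* Let $q$ be a power of $2$. Then $DI(q)\subset W5(q)$.
   Context: Let $D=\sum_{n>0,\ \gcd(n,6)=1}x^{n^2}\in\mathbb{Z}/2[[x]]$. $W5(q)$ is the $\mathbb{Z}/2$-span of the $D^n$ with $n>0$, $n\equiv5\pmod6$ and $n<12q^2$. Let $p_{3,2}:\mathbb{Z}/2[[x]]\to\mathbb{Z}/2[[x]]$ send $\sum c_nx^n$ to $\sum_{n\equiv2\ (3)}c_nx^n$. Every ideal of $\mathbb{Z}[i]$ of odd norm has a generator $a+2bi$ with $a$ odd, unique up to sign. Two such ideals $(\alpha),(\beta)$ (generators of this form) are Gauss-equivalent if there is an integer $N$ with $N\alpha\equiv\beta\pmod{4q\mathbb{Z}[i]}$; the equivalence classes are Gauss-classes. $\mathit{AMB}$ is the Gauss-class consisting of the ideals $(a+2bqi)$ with $a,b$ odd. For a Gauss-class $R$, $\theta(R)=\sum_{I\in R}x^{\mathrm{norm}(I)}\in\mathbb{Z}[[x]]$; $\theta(\mathit{AMB})\in2\mathbb{Z}[[x]]$. $DI(q)$ is the image under $p_{3,2}$ of the $\mathbb{Z}/2$-span of the mod $2$ reductions of all $\theta(R)$ ($R$ a Gauss-class) and of $\tfrac12\theta(\mathit{AMB})$. *)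

(* Defs.v *)
From HB Require Import structures.
From mathcomp Require Import all_boot all_order all_algebra.
From mathcomp Require Import finmap ring.
From mathcomp Require Import boolp classical_sets functions cardinality.

Set Implicit Arguments.
Unset Strict Implicit.
Unset Printing Implicit Defensive.

Import GRing.Theory.

Local Open Scope classical_set_scope.
Local Open Scope ring_scope.

(* Formal power series R[[x]], as a commutative R-algebra. [f n] is the       *)
(* coefficient of x^n. The type is a record so that the Cauchy product below  *)
(* cannot be confused with the pointwise product on [nat -> R].               *)
Record fps (R : Type) := Fps { fps_coef :> nat -> R }.

Lemma fps_coefK (R : Type) : cancel (@fps_coef R) (@Fps R).
Proof. by case. Qed.

HB.instance Definition _ (R : choiceType) :=
  Choice.copy (fps R) (can_type (@fps_coefK R)).

Lemma fpsP (R : Type) (f g : fps R) : (forall n, f n = g n) <-> f = g.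
Proof.
by split=> [|-> //]; case: f g => [f] [g] /= fg; congr Fps; apply: funext.
Qed.

Section FpsRing.
Variable R : comNzRingType.
Implicit Types f g h : fps R.

Definition fps_zero : fps R := Fps (fun=> 0).
Definition fps_one : fps R := Fps (fun n => (n == 0%N)%:R).
Definition fps_opp f : fps R := Fps (fun n => - f n).
Definition fps_add f g : fps R := Fps (fun n => f n + g n).
Definition fps_mul f g : fps R := Fps (fun n => \sum_(i < n.+1) f i * g (n - i)%N).
Definition fps_scale (c : R) f : fps R := Fps (fun n => c * f n).

Fact fps_addA : associative fps_add.
Proof. by move=> f g h; apply/fpsP => n /=; rewrite addrA. Qed.
Fact fps_addC : commutative fps_add.
Proof. by move=> f g; apply/fpsP => n /=; rewrite addrC. Qed.
Fact fps_add0 : left_id fps_zero fps_add.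
Proof. by move=> f; apply/fpsP => n /=; rewrite add0r. Qed.
Fact fps_addN : left_inverse fps_zero fps_opp fps_add.
Proof. by move=> f; apply/fpsP => n /=; rewrite addNr. Qed.

HB.instance Definition _ := GRing.isZmodule.Build (fps R)
  fps_addA fps_addC fps_add0 fps_addN.

Definition fps_trunc n f : {poly R} := \poly_(i < n.+1) f i.

Lemma fps_mul_trunc m n f g :
  (n <= m)%N -> fps_mul f g n = (fps_trunc m f * fps_trunc m g)`_n.
Proof.
move=> nm; rewrite coefM; apply: eq_bigr => i _; rewrite !coef_poly.
have im : (i < m.+1)%N by rewrite (leq_trans (ltn_ord i)).
have nim : (n - i < m.+1)%N by rewrite ltnS (leq_trans (leq_subr _ _)).
by rewrite im nim.
Qed.

Fact fps_mulA : associative fps_mul.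
Proof.
move=> f g h; apply/fpsP => n; rewrite !(@fps_mul_trunc n) //.
transitivity ((fps_trunc n f * (fps_trunc n g * fps_trunc n h))`_n).
  rewrite !coefM; apply: eq_bigr => i _; congr (_ * _).
  by rewrite coef_poly ltnS leq_subr (@fps_mul_trunc n) // leq_subr.
rewrite mulrA !coefM; apply: eq_bigr => i _; congr (_ * _).
have le_in : (i <= n)%N by rewrite -ltnS.
by rewrite coef_poly ltnS le_in (@fps_mul_trunc n).
Qed.
Fact fps_mulC : commutative fps_mul.
Proof. by move=> f g; apply/fpsP => n; rewrite !(@fps_mul_trunc n) // mulrC. Qed.
Fact fps_mul1 : left_id fps_one fps_mul.
Proof.
move=> f; apply/fpsP => n /=; rewrite big_ord_recl /= mul1r subn0.
by rewrite big1 ?addr0 // => i _; rewrite mul0r.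
Qed.
Fact fps_mulDl : left_distributive fps_mul fps_add.
Proof.
move=> f g h; apply/fpsP => n /=; rewrite -big_split /=.
by apply: eq_bigr => i _; rewrite mulrDl.
Qed.
Fact fps_one_neq0 : fps_one != 0.
Proof.
apply/eqP => /fpsP /(_ 0%N) /= /eqP.
by rewrite oner_eq0.
Qed.

HB.instance Definition _ := GRing.Zmodule_isComNzRing.Build (fps R)
  fps_mulA fps_mulC fps_mul1 fps_mulDl fps_one_neq0.

Fact fps_scaleA a b f : fps_scale a (fps_scale b f) = fps_scale (a * b) f.
Proof. by apply/fpsP => n /=; rewrite mulrA. Qed.
Fact fps_scale1 : left_id 1 fps_scale.
Proof. by move=> f; apply/fpsP => n /=; rewrite mul1r. Qed.
Fact fps_scaleDr : right_distributive fps_scale +%R.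
Proof. by move=> a f g; apply/fpsP => n /=; rewrite mulrDr. Qed.
Fact fps_scaleDl f : {morph fps_scale^~ f : a b / a + b}.
Proof. by move=> a b; apply/fpsP => n /=; rewrite mulrDl. Qed.

HB.instance Definition _ := GRing.Zmodule_isLmodule.Build R (fps R)
  fps_scaleA fps_scale1 fps_scaleDr fps_scaleDl.

Fact fps_scaleAl (a : R) f g : a *: (f * g) = a *: f * g.
Proof.
apply/fpsP => n /=; rewrite big_distrr /=.
by apply: eq_bigr => i _; rewrite mulrA.
Qed.

HB.instance Definition _ := GRing.Lmodule_isLalgebra.Build R (fps R) fps_scaleAl.

End FpsRing.

Definition linear_span (K : fieldType) (V : lmodType K) (S : set V) : set V :=
  [set v | exists (n : nat) (c : 'I_n -> K) (u : 'I_n -> V),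
     (forall i, S (u i)) /\ v = \sum_(i < n) c i *: u i].

(* [Gint a b] is a + b i in Z[i].                                             *)
Record gint := Gint { gre : int; gim : int }.

Definition gint_pair (z : gint) : int * int := (gre z, gim z).
Definition pair_gint (p : int * int) : gint := Gint p.1 p.2.

Lemma gint_pairK : cancel gint_pair pair_gint. Proof. by case. Qed.

HB.instance Definition _ := Countable.copy gint (can_type gint_pairK).

Definition gint_opp z := Gint (- gre z) (- gim z).
Definition gint_add z w := Gint (gre z + gre w) (gim z + gim w).
Definition gint_mul z w :=
  Gint (gre z * gre w - gim z * gim w) (gre z * gim w + gim z * gre w).

Fact gint_addA : associative gint_add.
Proof. by move=> z w v; rewrite /gint_add /= !addrA. Qed.
Fact gint_addC : commutative gint_add.
Proof. by move=> z w; congr Gint; rewrite addrC. Qed.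
Fact gint_add0 : left_id (Gint 0 0) gint_add.
Proof. by case=> a b; rewrite /gint_add /= !add0r. Qed.
Fact gint_addN : left_inverse (Gint 0 0) gint_opp gint_add.
Proof. by case=> a b; rewrite /gint_add /= !addNr. Qed.

HB.instance Definition _ := GRing.isZmodule.Build gint
  gint_addA gint_addC gint_add0 gint_addN.

Fact gint_mulA : associative gint_mul.
Proof. by move=> z w v; congr Gint => /=; ring. Qed.
Fact gint_mulC : commutative gint_mul.
Proof. by move=> z w; congr Gint => /=; ring. Qed.
Fact gint_mul1 : left_id (Gint 1 0) gint_mul.
Proof. by case=> a b; congr Gint => /=; ring. Qed.
Fact gint_mulDl : left_distributive gint_mul gint_add.
Proof. by move=> z w v; congr Gint => /=; ring. Qed.
Fact gint_one_neq0 : Gint 1 0 != 0. Proof. by []. Qed.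

HB.instance Definition _ := GRing.Zmodule_isComNzRing.Build gint
  gint_mulA gint_mulC gint_mul1 gint_mulDl gint_one_neq0.

(* [idealr_closed] of the library excludes the unit ideal, which is needed    *)
(* here (it has norm 1).                                                      *)
Definition is_ideal (I : set gint) : Prop :=
  I 0 /\ (forall x y z : gint, I y -> I z -> I (x * y + z)).

Definition principal (z : gint) : set gint := [set w | exists v, w = v * z].

(* The index of I in Z[i]; the junk value of [fset_set] on infinite sets      *)
(* gives the zero ideal its usual norm 0.                                     *)
Definition ideal_norm (I : set gint) : nat :=
  #|` fset_set [set C : set gint | exists x, C = [set y | I (y - x)]] |%fset.

Definition odd_ideal : set (set gint) :=
  [set I | is_ideal I /\ odd (ideal_norm I)].

Definition oddz (a : int) : bool := odd `|a|%N.

Definition normal_generator (I : set gint) (z : gint) : Prop :=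
  (exists a b : int, oddz a /\ z = Gint a (2 * b)) /\ I = principal z.

Definition gauss_equiv (q : nat) (I J : set gint) : Prop :=
  exists z w : gint, [/\ normal_generator I z, normal_generator J w &
    exists (N : int) (v : gint), N%:~R * z = w + (4 * q)%:R * v].

Definition gauss_class (q : nat) (C : set (set gint)) : Prop :=
  exists2 I, odd_ideal I & C = [set J | odd_ideal J /\ gauss_equiv q I J].

Definition AMB (q : nat) : set (set gint) :=
  [set I | exists a b : int,
     [/\ oddz a, oddz b & I = principal (Gint a (2 * b * q%:Z))]].

Definition theta (C : set (set gint)) : fps int :=
  Fps (fun n => (#|` fset_set [set I | C I /\ ideal_norm I = n] |%fset)%:Z).

Definition red2 (f : fps int) : fps 'F_2 := Fps (fun n => (f n)%:~R).

(* Only used on series with even coefficients.                                *)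
Definition half_fps (f : fps int) : fps int := Fps (fun n => (f n %/ 2)%Z).

Definition p32 (f : fps 'F_2) : fps 'F_2 :=
  Fps (fun n => if (n %% 3 == 2)%N then f n else 0).

Definition D : fps 'F_2 :=
  Fps (fun n => \sum_(m < n.+1 | [&& 0 < m, coprime m 6 & m ^ 2 == n]%N) 1).

Definition W5 (q : nat) : set (fps 'F_2) :=
  linear_span [set f | exists n : nat,
    [/\ (0 < n)%N, (n %% 6 = 5)%N, (n < 12 * q ^ 2)%N & f = D ^+ n]].

Definition DI (q : nat) : set (fps 'F_2) :=
  p32 @` linear_span [set f |
    (exists2 C, gauss_class q C & f = red2 (theta C))
    \/ f = red2 (half_fps (theta (AMB q)))].

(* Main.v *)
(** Put d_M(a) = sum of x^(n^2) over the integers n = a (mod M) prime to 3 and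
    h_M(a) = sum of x^(3 n^2) over n = a (mod M), for M a power of 2. The ideals
    of a Gauss-class are the (a + 2bi) with a > 0 odd and b/a in a fixed residue
    class modulo 2q; modulo 2, the image under p_{3,2} of its theta series is
    either 0 or a sum of d_M(r) d_M(kr)^Q over the classes r of (Z/M)^*/{1, -1},
    with Q a power of 4.

    In characteristic 2 the identities n^2 + m^2 = 2 (c^2 + e^2) and
    n^2 + 3 m^2 = 4 (c^2 + 3 e^2) become Riemann-type theta relations, since
    f(x^2) = f^2. The first makes the h_M(a) generate a tower of Artin-Schreier
    extensions over h_4(1): with z = h_2M(a) / h_M(a), z^2 + z is a function of
    level M and the relations are equivariant under a -> ua. The second gives
    h_4(1) = D^3 and expresses d_M(a) rationally in the tower. Summing over
    (Z/M)^*/{1, -1} is then a trace down to F_2[D, 1/D]. Finally the degree in D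
    is bounded because d_M(a) / D^(M^2/4 - 3) is integral over F_2[1/D], and the
    exponents are sorted out by the congruence of the support modulo 6. *)
Require Import Defs.
From HB Require Import structures.
From mathcomp Require Import all_boot all_order all_algebra.
From mathcomp Require Import finmap fraction.
From mathcomp Require Import boolp classical_sets cardinality fsbigop.
From mathcomp Require Import ring zify.

Set Implicit Arguments.
Unset Strict Implicit.
Unset Printing Implicit Defensive.

Import Order.TTheory GRing.Theory Num.Theory.

Local Open Scope classical_set_scope.
Local Open Scope ring_scope.

(** * Laurent polynomials and degree at infinity *)

(** The tower is not shown to have full degree and no Galois group is built. Instead,
    [equivariant m e] says that all values e(a), a odd, come from one expression in the generators
    z(a) with coefficients in F_2[D, 1/D] independent of a; replacing a by ua plays the part of an
    automorphism. The trace is then explicit: a -> a + M/2 adds 1 to the top z and fixes the lower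
    ones, so in characteristic 2 each conjugate pair leaves only the coefficient of z.

    1/D enters because 1/h_2M(a) is a conjugate divided by a norm that contains a power of D. That
    the final sum is a polynomial in D is seen from two sides: integrality bounds the exponents from
    above, and D^n = x^n + ... excludes negative ones for a power series in x.

    If a + 2bi lies in the class of a0 + 2 b0 i and 2^i is the exact power of 2 in b0, with 2^i < q,
    then M = 2q/2^i and Q = 4^(i+1). The degree is at most (M^2/4 - 3)(Q + 1) < 5q^2, well within
    12q^2. *)

Section Laurent.
Variables (F K : fieldType) (iota : {rmorphism F -> K}) (D : K).
Hypothesis D_neq0 : D != 0.

Definition laurent_in (x : K) : Prop :=
  exists N (p : {poly F}), x * D ^+ N = (map_poly iota p).[D].

Lemma laurent_const c : laurent_in (iota c).
Proof. by exists 0%N, c%:P; rewrite expr0 mulr1 map_polyC hornerC. Qed.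

Lemma laurent0 : laurent_in 0.
Proof. by rewrite -(rmorph0 iota); exact: laurent_const. Qed.

Lemma laurent1 : laurent_in 1.
Proof. by rewrite -(rmorph1 iota); exact: laurent_const. Qed.

Lemma laurent_gen : laurent_in D.
Proof. by exists 0%N, 'X; rewrite expr0 mulr1 map_polyX hornerX. Qed.

Lemma laurent_genV : laurent_in D^-1.
Proof. by exists 1%N, 1; rewrite expr1 mulVf // rmorph1 hornerC. Qed.

Lemma laurentD x y : laurent_in x -> laurent_in y -> laurent_in (x + y).
Proof.
move=> [N [p px]] [M [r ry]]; exists (N + M)%N, (p * 'X^M + r * 'X^N).
rewrite rmorphD !rmorphM /= !map_polyXn !hornerE -px -ry exprD; ring.
Qed.

Lemma laurentM x y : laurent_in x -> laurent_in y -> laurent_in (x * y).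
Proof.
move=> [N [p px]] [M [r ry]]; exists (N + M)%N, (p * r).
by rewrite rmorphM hornerM -px -ry exprD; ring.
Qed.

Lemma laurentX x n : laurent_in x -> laurent_in (x ^+ n).
Proof.
move=> Lx; elim: n => [|n IH]; first exact: laurent1.
by rewrite exprS; exact: laurentM.
Qed.

Lemma horner_genV_comm : commr_rmorph iota D^-1.
Proof. by move=> x; exact: mulrC. Qed.

Definition eval_genV : {rmorphism {poly F} -> K} := horner_morph horner_genV_comm.

Lemma eval_genV_gen n : eval_genV 'X^n = D ^- n.
Proof. by rewrite /= /horner_morph map_polyXn hornerXn exprVn. Qed.

Lemma integral_genV n : integralOver eval_genV (D ^- n).
Proof. by rewrite -eval_genV_gen; exact: integral_id. Qed.

Lemma integral_exp x n : integralOver eval_genV x -> integralOver eval_genV (x ^+ n).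
Proof.
move=> ix; elim: n => [|n IH]; first by rewrite expr0; exact: integral1.
by rewrite exprS; exact: integral_mul.
Qed.

(* [x] has degree at most [w] in D: the place at infinity of F(D) is the one  *)
(* where 1/D vanishes.                                                        *)
Definition deg_le (w : nat) (x : K) : Prop := integralOver eval_genV (x / D ^+ w).

Lemma deg_leW v w x : (v <= w)%N -> deg_le v x -> deg_le w x.
Proof.
move=> vw dx; rewrite /deg_le -(subnK vw) addnC exprD invfM mulrA.
by apply: integral_mul => //; exact: integral_genV.
Qed.

Lemma deg_leM v w x y : deg_le v x -> deg_le w y -> deg_le (v + w) (x * y).
Proof.
move=> dx dy; rewrite /deg_le.
have -> : x * y / D ^+ (v + w) = (x / D ^+ v) * (y / D ^+ w).
  by rewrite exprD invfM; ring.
exact: integral_mul.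
Qed.

Lemma deg_leD w x y : deg_le w x -> deg_le w y -> deg_le w (x + y).
Proof. by move=> dx dy; rewrite /deg_le mulrDl; exact: integral_add. Qed.

Lemma deg_leX w x n : deg_le w x -> deg_le (w * n) (x ^+ n).
Proof. by move=> dx; rewrite /deg_le exprM -expr_div_n; exact: integral_exp. Qed.

Lemma deg_le_gen n : deg_le n (D ^+ n).
Proof. by rewrite /deg_le divff ?expf_neq0 //; exact: integral1. Qed.

Lemma deg_le_sum (I : Type) (r : seq I) w (f : I -> K) :
  (forall i, deg_le w (f i)) -> deg_le w (\sum_(i <- r) f i).
Proof.
move=> df; elim: r => [|i r IH]; last by rewrite big_cons; exact: deg_leD.
by rewrite big_nil /deg_le mul0r; exact: integral0.
Qed.

(** With n the degree of p, x / D^w is a root of the monic polynomial with coefficients p_i / D^(w(n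
    - i)), all integral over F[1/D]. *)
Lemma deg_le_root w x (p : {poly K}) : p \is monic -> root p x ->
  (forall i, (i < (size p).-1)%N -> deg_le (w * ((size p).-1 - i)) p`_i) -> deg_le w x.
Proof.
move=> mp rx dp; pose n := (size p).-1.
pose r : {poly K} := \poly_(i < n.+1) (p`_i / D ^+ (w * (n - i))).
have sp : size p = n.+1 by rewrite prednK // size_poly_gt0 monic_neq0.
have lp : p`_n = 1 by move/monicP: mp.
have rn : r`_n = 1 by rewrite coef_poly ltnSn subnn muln0 expr0 divr1.
have sr : size r = n.+1.
  by apply: size_poly_eq; rewrite subnn muln0 expr0 divr1 lp oner_neq0.
apply: (@integral_root_monic _ _ eval_genV _ r).
- by rewrite monicE lead_coefE sr /= rn.
- move/rootP: rx => rx; apply/rootP; rewrite horner_coef sr.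
  rewrite -[RHS](mul0r (D ^+ (w * n))^-1) -[in RHS]rx horner_coef sp big_distrl /=.
  apply: eq_bigr => i _; rewrite coef_poly ltn_ord.
  have le_in : (i <= n)%N by rewrite -ltnS.
  have -> : D ^+ (w * n) = D ^+ (w * (n - i)) * (D ^+ w) ^+ i.
    by rewrite -exprM -exprD -mulnDr subnK.
  by rewrite expr_div_n invfM; ring.
- apply/integral_poly => i; rewrite coef_poly; case: ltnP => [|_]; last exact: integral0.
  rewrite ltnS leq_eqVlt => /orP[/eqP ->|lt_in]; last exact: dp.
  by rewrite lp subnn muln0 expr0 divr1; exact: integral1.
Qed.

Definition rev_poly n (p : {poly F}) : {poly F} := \poly_(i < n.+1) p`_(n - i).

Lemma horner_rev_poly n (p : {poly F}) : (size p <= n.+1)%N ->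
  (map_poly iota (rev_poly n p)).[D^-1] = (map_poly iota p).[D] / D ^+ n.
Proof.
move=> sp; rewrite (@horner_coef_wide _ n.+1); last first.
  by rewrite size_map_poly size_poly.
rewrite (@horner_coef_wide _ n.+1 (map_poly iota p)) ?size_map_poly //.
rewrite big_distrl /= (reindex_inj rev_ord_inj) /=; apply: eq_bigr => i _.
have le_in : (i <= n)%N by rewrite -ltnS.
rewrite !coef_map coef_poly subSS ltnS leq_subr subKn // -mulrA; congr (_ * _).
by rewrite exprVn -[n in D ^+ n](subnKC le_in) exprD invfM mulrA divff ?mul1r ?expf_neq0.
Qed.

(** Reversing coefficients turns a relation for 1/D into one for D. *)
Lemma transcendental_genV :
    (forall p : {poly F}, root (map_poly iota p) D -> p = 0) ->
  forall p : {poly F}, root (map_poly iota p) D^-1 -> p = 0.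
Proof.
move=> trD p /rootP rp; pose n := size p.
have sr : (size (rev_poly n p) <= n.+1)%N by exact: size_poly.
have rK : rev_poly n (rev_poly n p) = p.
  apply/polyP => i; rewrite !coef_poly !ltnS leq_subr.
  by case: leqP => [le_in|lt_ni]; [rewrite subKn | rewrite nth_default // ltnW].
have /trD r0 : root (map_poly iota (rev_poly n p)) D.
  move: (horner_rev_poly sr); rewrite rK rp => /esym/eqP.
  by rewrite mulf_eq0 invr_eq0 (negPf (expf_neq0 _ D_neq0)) orbF.
by rewrite -rK r0; apply/polyP => i; rewrite coef_poly !coef0 if_same.
Qed.

(** Otherwise u = x / D^w would have a pole at T = 1/D = 0. Precisely, u T^(k+1) = g(T) with g the
    reversal of p, so g(0) is the leading coefficient of p. The monic equation of u, of degree n and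
    multiplied by T^((k+1)n), is a polynomial identity in T; at T = 0 it reads g(0)^n = 0. *)
Lemma laurent_size_le w x :
    (forall p : {poly F}, root (map_poly iota p) D -> p = 0) ->
  deg_le w x -> forall N (p : {poly F}),
  x * D ^+ N = (map_poly iota p).[D] -> (size p <= (N + w).+1)%N.
Proof.
move=> trD [c mc /rootP]; set u := x / _ => rc N p xp.
rewrite leqNgt; apply/negP => big.
have p0 : p != 0 by rewrite -size_poly_gt0 (leq_trans _ big).
have [d sp] : exists d, size p = d.+1 by case: (size p) big => // d _; exists d.
have [k dE] : exists k, d = (N + w + k.+1)%N.
  by exists (d - (N + w).+1)%N; rewrite addnS -addSn subnKC // -ltnS -sp.
pose n := (size c).-1; pose g := rev_poly d p.
have sc : size c = n.+1 by rewrite prednK // size_poly_gt0 monic_neq0.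
have gu : (map_poly iota g).[D^-1] = u * D^-1 ^+ k.+1.
  rewrite horner_rev_poly ?sp // -xp /u dE !exprD exprVn.
  by field; rewrite !expf_neq0.
pose Q : {poly F} := \sum_(i < n.+1) c`_i * 'X^(k.+1 * (n - i)) * g ^+ i.
have Q0 : Q = 0.
  apply: transcendental_genV => //; apply/rootP.
  rewrite rmorph_sum horner_sum -[RHS](mul0r (D^-1 ^+ (k.+1 * n))) -[in RHS]rc.
  rewrite horner_coef size_map_poly_id0 ?sc; last first.
    by rewrite (monicP mc) rmorph1 oner_neq0.
  rewrite big_distrl /=; apply: eq_bigr => i _.
  have le_in : (i <= n)%N by rewrite -ltnS.
  rewrite !rmorphM rmorphXn /= map_polyXn !hornerE gu coef_map /=.
  have -> : D^-1 ^+ (k.+1 * n) = D^-1 ^+ (k.+1 * (n - i)) * (D^-1 ^+ k.+1) ^+ i.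
    by rewrite -exprM -exprD -mulnDr subnK.
  by rewrite exprMn /horner_morph; ring.
have : Q.[0] != 0.
  rewrite horner_sum big_ord_recr /= big1 => [|i _]; last first.
    rewrite !hornerE expr0n muln_eq0 /= subn_eq0 leqNgt ltn_ord /=.
    by rewrite mulr0 mul0r.
  rewrite add0r subnn muln0 mulr1 -[c`_n](_ : 1 = _); last first.
    by move/monicP: mc; rewrite lead_coefE.
  rewrite mul1r hornerE expf_neq0 // horner_coef0 coef_poly subn0 ltnS leq0n.
  by rewrite -[d]/(d.+1.-1) -sp -lead_coefE lead_coef_eq0.
by rewrite Q0 horner0 eqxx.
Qed.

End Laurent.

(** * The theta tower *)

Lemma oddzP (a : int) : reflect (exists b, a = 2 * b + 1) (oddz a).
Proof.
rewrite /oddz; apply: (iffP idP) => [oa|[b ->]]; last by lia.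
exists (a %/ 2)%Z; lia.
Qed.

Lemma oddzM a b : oddz a -> oddz b -> oddz (a * b).
Proof. by rewrite /oddz abszM oddM => -> ->. Qed.

Lemma oddz_mod4 (a : int) : oddz a ->
  (exists k, a = 1 + k * 4) \/ (exists k, a = - 1 + k * 4).
Proof.
case/oddzP => b ->; have [bE|bE] : (b = 2 * (b %/ 2)%Z \/ b = 2 * (b %/ 2)%Z + 1) by lia.
  by left; exists (b %/ 2)%Z; lia.
by right; exists ((b %/ 2)%Z + 1); lia.
Qed.

Lemma oddzNP (v : int) : ~~ oddz v -> exists w, v = 2 * w.
Proof. by rewrite /oddz => ov; exists (v %/ 2)%Z; lia. Qed.

Lemma oddzD2 a m : oddz a -> oddz (a + 2 ^+ m.+1).
Proof. by case/oddzP => b ->; apply/oddzP; exists (b + 2 ^+ m); rewrite exprS; ring. Qed.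

Lemma oddz1D2 m (k : int) : oddz (1 + k * 2 ^+ m.+1).
Proof. by apply/oddzP; exists (k * 2 ^+ m); rewrite exprS; ring. Qed.

(** The index m stands for the modulus 2^m. The values lie in a field because the tower divides by
    the h m a. *)
Record theta_system (K : fieldType) (h d : nat -> int -> K) : Prop := ThetaSystem {
  ts_char2 : 1 + 1 = 0 :> K;
  ts_h_per : forall m (a k : int), h m (a + k * 2 ^+ m) = h m a;
  ts_d_per : forall m (a k : int), d m (a + k * 2 ^+ m) = d m a;
  ts_h_opp : forall m (a : int), h m (- a) = h m a;
  ts_d_opp : forall m (a : int), d m (- a) = d m a;
  ts_h_split : forall m (a : int), h m a = h m.+1 a + h m.+1 (a + 2 ^+ m);
  ts_d_split : forall m (a : int), d m a = d m.+1 a + d m.+1 (a + 2 ^+ m);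
  ts_h_double : forall m (a : int), h m.+1 (2 * a) = h m a ^+ 4;
  ts_d_double : forall m (a : int), d m.+1 (2 * a) = d m a ^+ 4;
  ts_h0 : h 0%N 0 = 1;
  ts_d0 : d 0%N 0 = 0;
  ts_D_neq0 : d 2%N 1 != 0;
  ts_riemann : forall m (c e : int), h m.+1 (c - e) * h m.+1 (c + e) =
    (h m.+1 c * h m.+1 e + h m.+1 (c + 2 ^+ m) * h m.+1 (e + 2 ^+ m)) ^+ 2;
  ts_isogeny : forall m (c e : int), d m.+2 (c + 3 * e) * h m.+2 (e - c) =
    (d m.+2 c * h m.+2 e +
     d m.+2 (c + 2 ^+ m) * h m.+2 (e + 2 ^+ m) +
     d m.+2 (c + 2 * 2 ^+ m) * h m.+2 (e + 2 * 2 ^+ m) +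
     d m.+2 (c + 3 * 2 ^+ m) * h m.+2 (e + 3 * 2 ^+ m)) ^+ 4 }.

Section Tower.
Variables (F K : fieldType) (iota : {rmorphism F -> K}) (h d : nat -> int -> K).
Hypothesis ts : theta_system h d.

Let D := d 2 1.
Let D_neq0 : D != 0 := ts_D_neq0 ts.

Lemma ts_addxx (x : K) : x + x = 0.
Proof. by rewrite -[x]mul1r -mulrDl (ts_char2 ts) mul0r. Qed.

(** Identities special to characteristic 2 are proved as identities over any commutative ring or
    field, with the discarded multiple of 2 given explicitly as t. *)
Lemma ts_eq (x y t : K) : x = y + (1 + 1) * t -> x = y.
Proof. by rewrite (ts_char2 ts) mul0r addr0. Qed.

Lemma ts_d0E a : d 0 a = 0.
Proof. by rewrite -[a]add0r -[a]mulr1 -(expr0 2) (ts_d_per ts) (ts_d0 ts). Qed.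

Lemma ts_h0E a : h 0 a = 1.
Proof. by rewrite -[a]add0r -[a]mulr1 -(expr0 2) (ts_h_per ts) (ts_h0 ts). Qed.

(** h 0 0 = 1 splits as h 1 0 + h 1 1, and h 1 0 = (h 0 0)^4 is already 1. *)
Lemma ts_h1_odd : h 1 1 = 0.
Proof.
have := ts_h_split ts 0 0; rewrite ts_h0E -[X in h 1 X](mulr0 2) (ts_h_double ts).
by rewrite ts_h0E expr1n -{1}[1]addr0 => /addrI.
Qed.

Lemma ts_h_dbl2 m n : h (m + n) (2 ^+ n) = h m 1 ^+ (4 ^ n).
Proof.
elim: n => [|n IH]; first by rewrite addn0 expr0 expr1.
by rewrite addnS exprS (ts_h_double ts) IH -exprM expnSr.
Qed.

Lemma ts_h_half m : h m.+1 (2 ^+ m) = 0.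
Proof. by rewrite -add1n ts_h_dbl2 ts_h1_odd expr0n expn_eq0. Qed.

Lemma ts_h_zero m : h m 0 = 1.
Proof.
by elim: m => [|m IH]; rewrite ?ts_h0E // -[0 : int](mulr0 2) (ts_h_double ts) IH expr1n.
Qed.

Lemma ts_d1E a : d 1 (2 * a) = 0.
Proof. by rewrite (ts_d_double ts) ts_d0E expr0n. Qed.

Lemma ts_d1 a : d 1 a = 0.
Proof.
have d1 : d 1 1 = 0.
  by have := ts_d_split ts 0 0; rewrite ts_d0E -[X in d 1 X](mulr0 2) ts_d1E add0r => <-.
have -> : a = (a %% 2)%Z + (a %/ 2)%Z * 2 ^+ 1 by lia.
rewrite (ts_d_per ts); have [->|->] : (a %% 2)%Z = 2 * 0 \/ (a %% 2)%Z = 1 by lia.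
  exact: ts_d1E.
exact: d1.
Qed.

Lemma ts_d2_even a : d 2 (2 * a) = 0.
Proof. by rewrite (ts_d_double ts) ts_d1 expr0n. Qed.

Lemma ts_h_eq m a b k : a = b + k * 2 ^+ m -> h m a = h m b.
Proof. by move=> ->; rewrite (ts_h_per ts). Qed.

Lemma ts_d_eq m a b k : a = b + k * 2 ^+ m -> d m a = d m b.
Proof. by move=> ->; rewrite (ts_d_per ts). Qed.

Lemma ts_h_eqN m a b k : a = - b + k * 2 ^+ m -> h m a = h m b.
Proof. by move=> ->; rewrite (ts_h_per ts) (ts_h_opp ts). Qed.

Lemma ts_d_eqN m a b k : a = - b + k * 2 ^+ m -> d m a = d m b.
Proof. by move=> ->; rewrite (ts_d_per ts) (ts_d_opp ts). Qed.

Lemma ts_d2_odd a : oddz a -> d 2 a = D.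
Proof.
move=> oa; have [[k aE]|[k aE]] := oddz_mod4 oa.
- exact: (@ts_d_eq 2 _ _ k).
- exact: (@ts_d_eqN 2 _ _ k).
Qed.

(** The isogeny relation for c = 1, e = 0 shrinks to D h = D^4, since d vanishes at even arguments
    and h at half the modulus. *)
Lemma ts_h2_1 : h 2 1 = D ^+ 3.
Proof.
have := ts_isogeny ts 0 1 0.
rewrite expr0 !mulr1 !mulr0 !add0r !addr0 (ts_h_opp ts) ts_h_zero !mulr1.
rewrite (ts_h_half 1 : h 2 2 = 0) mulr0 addr0.
rewrite (_ : 1 + 1 = 2 * 1 :> int) // (_ : 1 + 3 = 2 * 2 :> int) // !ts_d2_even !mul0r !addr0.
by rewrite exprS => /(mulfI D_neq0).
Qed.

Lemma ts_h2_odd a : oddz a -> h 2 a = D ^+ 3.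
Proof.
move=> oa; rewrite -ts_h2_1.
have [[k aE]|[k aE]] := oddz_mod4 oa.
- exact: (@ts_h_eq 2 _ _ k).
- exact: (@ts_h_eqN 2 _ _ k).
Qed.

Lemma ts_h_quarter m : h m.+2 (2 ^+ m) = D ^+ (3 * 4 ^ m).
Proof. by rewrite -add2n ts_h_dbl2 ts_h2_1 exprM. Qed.

Lemma ts_h_conj m a : h m.+2 (a + 2 ^+ m.+1) = h m.+1 a + h m.+2 a.
Proof. by rewrite (ts_h_split ts m.+1 a) addrAC ts_addxx add0r. Qed.

(** The norm of [h m.+3 a] over the level below. In the Riemann relation take c a quarter of the
    modulus: c and c plus half the modulus are then opposite, so h(c) factors out and the other two
    factors add up to one value of level [m.+2]. *)
Lemma ts_h_norm m a : h m.+3 a * h m.+3 (a + 2 ^+ m.+2) =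
  (D ^+ (3 * 4 ^ m.+1) * h m.+2 (a + 2 ^+ m.+1)) ^+ 2.
Proof.
have := ts_riemann ts m.+2 (2 ^+ m.+1) (2 ^+ m.+1 - a).
have -> : h m.+3 (2 ^+ m.+1 - (2 ^+ m.+1 - a)) = h m.+3 a by congr h; ring.
have -> : h m.+3 (2 ^+ m.+1 + (2 ^+ m.+1 - a)) = h m.+3 (a + 2 ^+ m.+2).
  by apply: (@ts_h_eqN _ _ _ 1); rewrite !exprS; ring.
have -> : h m.+3 (2 ^+ m.+1 + 2 ^+ m.+2) = h m.+3 (2 ^+ m.+1).
  by apply: (@ts_h_eqN _ _ _ 1); rewrite !exprS; ring.
move=> ->; rewrite -mulrDr -(ts_h_split ts) ts_h_quarter; congr ((_ * _) ^+ 2).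
by apply: (@ts_h_eqN _ _ _ 1); rewrite !exprS; ring.
Qed.

Lemma ts_h_neq0 m a : oddz a -> h m.+2 a != 0.
Proof.
elim: m a => [|m IH] a oa; first by rewrite ts_h2_odd ?expf_neq0.
have : h m.+3 a * h m.+3 (a + 2 ^+ m.+2) != 0.
  by rewrite ts_h_norm expf_neq0 // mulf_neq0 ?expf_neq0 // IH ?oddzD2.
by rewrite mulf_eq0 => /norP[].
Qed.

(** Dividing by the trace [h m.+2 a] makes this an Artin-Schreier generator: its conjugate is itself
    plus 1. *)
Definition ts_z m (a : int) : K := h m.+3 a / h m.+2 a.

Lemma ts_z_conj m a : oddz a -> ts_z m (a + 2 ^+ m.+2) = 1 + ts_z m a.
Proof.
move=> oa; rewrite /ts_z ts_h_conj.
have -> : h m.+2 (a + 2 ^+ m.+2) = h m.+2 a.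
  by apply: (@ts_h_eq _ _ _ 1); ring.
by rewrite mulrDl divff ?ts_h_neq0.
Qed.

Lemma ts_z_sqr m a : oddz a -> ts_z m a ^+ 2 =
  ts_z m a + (D ^+ (3 * 4 ^ m.+1) * h m.+2 (a + 2 ^+ m.+1) / h m.+2 a) ^+ 2.
Proof.
move=> oa; rewrite [X in _ = _ + X]expr_div_n -ts_h_norm ts_h_conj /ts_z.
have A0 := ts_h_neq0 m oa.
by apply: (@ts_eq _ _ (- (h m.+3 a / h m.+2 a))); field.
Qed.

(** Apply the Riemann relation to (c, e) and to (c + 2^(m+1), e). Squares add in characteristic 2,
    and (xy + x'y') + (x'y + xy') = (x + x')(y + y'). *)
Lemma ts_trace m c e :
  h m.+2 (c - e) * h m.+2 (c + e) +
    h m.+2 (c - e + 2 ^+ m.+1) * h m.+2 (c + e + 2 ^+ m.+1) = (h m.+1 c * h m.+1 e) ^+ 2.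
Proof.
have -> : c - e + 2 ^+ m.+1 = (c + 2 ^+ m.+1) - e by ring.
have -> : c + e + 2 ^+ m.+1 = (c + 2 ^+ m.+1) + e by ring.
rewrite !(ts_riemann ts).
have -> : h m.+2 (c + 2 ^+ m.+1 + 2 ^+ m.+1) = h m.+2 c.
  by apply: (@ts_h_eq _ _ _ 1); rewrite !exprS; ring.
rewrite !(ts_h_split ts m.+1).
set x := h _ c; set y := h _ e; set x' := h _ (c + _); set y' := h _ (e + _).
by apply: (@ts_eq _ _ (- (x * y + x' * y') * (x' * y + x * y'))); ring.
Qed.

(** [ts_trace] with c = (u + 1)a and e = ua has c - e = a and c + e = (2u + 1)a. In terms of x, y of
    the upper level and A, B of the lower one its left side is xy + (x + A)(y + B) = AB + Ay + Bx;
    division by AB gives 1 + z((2u + 1)a) + z(a). So z at an odd multiple of a differs from z(a) by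
    an element of the lower level. *)
Lemma ts_z_shift m u a : oddz a ->
  ts_z m ((2 * u + 1) * a) = ts_z m a +
   (1 + (h m.+2 ((u + 1) * a) * h m.+2 (u * a)) ^+ 2 *
       ((h m.+2 a)^-1 * (h m.+2 ((2 * u + 1) * a))^-1)).
Proof.
move=> oa; have ob : oddz ((2 * u + 1) * a) by rewrite oddzM //; apply/oddzP; exists u.
have := ts_trace m.+1 ((u + 1) * a) (u * a).
have -> : (u + 1) * a - u * a = a by ring.
have -> : (u + 1) * a + u * a = (2 * u + 1) * a by ring.
move=> <-; rewrite !ts_h_conj /ts_z.
set A := h m.+2 a; set B := h m.+2 ((2 * u + 1) * a).
have A0 : A != 0 by exact: ts_h_neq0.
have B0 : B != 0 by exact: ts_h_neq0.
set x := h m.+3 a; set y := h m.+3 _.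
by apply: (@ts_eq _ _ (- (1 + x / A + x * y / (A * B)))); field; rewrite A0 B0.
Qed.

(** Unfolded: e(a) is a polynomial of degree at most 1 in each of z_0(a), ..., z_(m-1)(a), with
    coefficients in F[D, 1/D] that do not depend on a. Only odd a are constrained. *)
Fixpoint equivariant (m : nat) (e : int -> K) : Prop :=
  match m with
  | 0%N => exists2 x, laurent_in iota D x & forall a, oddz a -> e a = x
  | m.+1 => exists al be, [/\ equivariant m al, equivariant m be &
              forall a, oddz a -> e a = al a + be a * ts_z m a]
  end.

Lemma equivariant_eq m e f : (forall a, oddz a -> e a = f a) ->
  equivariant m e -> equivariant m f.
Proof.
case: m => [|m] ef /=; first by case=> x Lx ex; exists x => // a oa; rewrite -ef ?ex.
by case=> al [be [Eal Ebe eE]]; exists al, be; split=> // a oa; rewrite -ef ?eE.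
Qed.

Lemma equivariant_const m x : laurent_in iota D x -> equivariant m (fun=> x).
Proof.
elim: m x => [|m IH] x Lx /=; first by exists x.
exists (fun=> x), (fun=> 0); split; [exact: IH | | by move=> a _; rewrite mul0r addr0].
by apply: IH; exact: laurent0.
Qed.

Lemma equivariantS m e : equivariant m e -> equivariant m.+1 e.
Proof.
move=> Ee; exists e, (fun=> 0); split=> //; last by move=> a _; rewrite mul0r addr0.
by apply: equivariant_const; exact: laurent0.
Qed.

Lemma equivariantD m e f :
  equivariant m e -> equivariant m f -> equivariant m (fun a => e a + f a).
Proof.
elim: m e f => [|m IH] e f /=.
  move=> [x Lx ex] [y Ly fy]; exists (x + y); first exact: laurentD.
  by move=> a oa; rewrite ex ?fy.
move=> [al [be [Eal Ebe eE]]] [al' [be' [Eal' Ebe' fE]]].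
exists (fun a => al a + al' a), (fun a => be a + be' a); split; [exact: IH..|].
by move=> a oa; rewrite eE ?fE //; ring.
Qed.

(** The term in z^2 is reduced by [ts_z_sqr]. Equivariance of its constant term is a hypothesis here
    because it comes out of the same induction. *)
Lemma equivariantM_step m :
  (forall e f, equivariant m e -> equivariant m f -> equivariant m (fun a => e a * f a)) ->
  equivariant m (fun a =>
    (D ^+ (3 * 4 ^ m.+1) * h m.+2 (a + 2 ^+ m.+1) / h m.+2 a) ^+ 2) ->
  forall e f, equivariant m.+1 e -> equivariant m.+1 f ->
    equivariant m.+1 (fun a => e a * f a).
Proof.
move=> EM Er e f [al [be [Eal Ebe eE]]] [al' [be' [Eal' Ebe' fE]]].
set r := (fun a : int => _) in Er.
exists (fun a => al a * al' a + be a * be' a * r a),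
  (fun a => al a * be' a + be a * al' a + be a * be' a); split.
- by apply: equivariantD; [|apply: (EM (fun a => _ * _))]; auto.
- by apply: equivariantD; [apply: equivariantD|]; apply: EM.
- move=> a oa; rewrite eE ?fE //.
  transitivity (al a * al' a + (al a * be' a + be a * al' a) * ts_z m a +
    be a * be' a * ts_z m a ^+ 2); first by ring.
  by rewrite ts_z_sqr // /r; ring.
Qed.

(** These closure properties form one induction: products and shifts at level m + 1 use h and 1/h at
    level m, and 1/h at level m + 1 uses products and shifts there. *)
Record equivariant_theory (m : nat) : Prop := EquivariantTheory {
  eqvM : forall e f, equivariant m e -> equivariant m f -> equivariant m (fun a => e a * f a);
  eqv_shift : forall (u : int) e, oddz u -> equivariant m e -> equivariant m (fun a => e (u * a));
  eqv_h : forall v : int, equivariant m (fun a => h m.+2 (v * a));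
  eqv_hV : forall v : int, oddz v -> equivariant m (fun a => (h m.+2 (v * a))^-1) }.

Lemma eqvX m e n : equivariant_theory m -> equivariant m e ->
  equivariant m (fun a => e a ^+ n).
Proof.
move=> T Ee; elim: n => [|n IH]; first by apply: equivariant_const; exact: laurent1.
by under eq_fun do rewrite exprS; exact: (eqvM T).
Qed.

(** For odd a the shift by half the modulus is a multiplication of a, hence covered by [eqv_h]. *)
Lemma ts_h_half_mul m a : oddz a -> h m.+1 (a + 2 ^+ m) = h m.+1 ((1 + 2 ^+ m) * a).
Proof.
by case/oddzP => b ->; apply: (@ts_h_eq _ _ _ (- b)); rewrite exprS; ring.
Qed.

(** Needed at the bottom of the tower, where [h 2] at an even multiple of a is a fourth power of
    [h 1]. *)
Lemma ts_h1_parity a : h 1 a = if oddz a then 0 else 1.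
Proof.
case: ifPn => [/oddzP[b ->]|oa].
  by rewrite -ts_h1_odd; apply: (@ts_h_eq _ _ _ b); rewrite expr1; ring.
rewrite -(ts_h_zero 1); apply: (@ts_h_eq _ _ _ (a %/ 2)%Z).
by move: oa; rewrite /oddz expr1; lia.
Qed.

Lemma equivariant_theory0 : equivariant_theory 0.
Proof.
split.
- move=> e f [x Lx ex] [y Ly fy]; exists (x * y); first exact: laurentM.
  by move=> a oa; rewrite ex ?fy.
- by move=> u e ou [x Lx ex]; exists x => // a oa; rewrite ex ?oddzM.
- move=> v; have [ov|/oddzNP[w ->]] := boolP (oddz v).
    exists (D ^+ 3); first by apply: laurentX; exact: laurent_gen.
    by move=> a oa; rewrite ts_h2_odd ?oddzM.
  exists (h 1 w ^+ 4).
    by apply: laurentX; rewrite ts_h1_parity; case: ifP => _; [exact: laurent0|exact: laurent1].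
  move=> a oa; rewrite -mulrA (ts_h_double ts) !ts_h1_parity; congr ((if _ then _ else _) ^+ 4).
  by rewrite /oddz abszM oddM [odd `|a|]oa andbT.
- move=> v ov; exists (D^-1 ^+ 3); first by apply: laurentX; exact: laurent_genV.
  by move=> a oa; rewrite ts_h2_odd ?oddzM // exprVn.
Qed.

Lemma equivariant_sqr_term m : equivariant_theory m -> equivariant m (fun a =>
  (D ^+ (3 * 4 ^ m.+1) * h m.+2 (a + 2 ^+ m.+1) / h m.+2 a) ^+ 2).
Proof.
move=> T; apply: (eqvX 2 T); apply: (eqvM T); last first.
  by apply: equivariant_eq (eqv_hV T (v := 1) _) => // a _; rewrite mul1r.
apply: (eqvM T); first by apply/equivariant_const/laurentX/laurent_gen.
by apply: equivariant_eq (eqv_h T (1 + 2 ^+ m.+1)) => a oa; rewrite ts_h_half_mul.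
Qed.

Lemma equivariant_theoryS m : equivariant_theory m -> equivariant_theory m.+1.
Proof.
move=> T.
have TM := equivariantM_step (eqvM T) (equivariant_sqr_term T).
have Tz : equivariant m.+1 (ts_z m).
  exists (fun=> 0), (fun=> 1); split; last by move=> a _; rewrite mul1r add0r.
    by apply: equivariant_const; exact: laurent0.
  by apply: equivariant_const; exact: laurent1.
have Tshift u e : oddz u -> equivariant m.+1 e -> equivariant m.+1 (fun a => e (u * a)).
  move=> ou [al [be [Eal Ebe eE]]]; case/oddzP: (ou) => w uE.
  apply: (@equivariant_eq _ (fun a => al (u * a) + be (u * a) * (ts_z m a +
    (1 + (h m.+2 ((w + 1) * a) * h m.+2 (w * a)) ^+ 2 *
       ((h m.+2 (1 * a))^-1 * (h m.+2 (u * a))^-1))))).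
    by move=> a oa; rewrite eE ?oddzM // uE (ts_z_shift m w oa) mul1r.
  apply: equivariantD; first by apply: equivariantS; exact: eqv_shift.
  apply: TM; first by apply: equivariantS; exact: eqv_shift.
  apply: equivariantD => //; apply: equivariantS; apply: equivariantD.
    by apply: equivariant_const; exact: laurent1.
  apply: (eqvM T); last by apply: (eqvM T); exact: (eqv_hV T).
  by apply: (eqvX 2 T); apply: (eqvM T); exact: (eqv_h T).
have Th : equivariant m.+1 (fun a => h m.+3 a).
  apply: (@equivariant_eq _ (fun a => h m.+2 (1 * a) * ts_z m a)).
    by move=> a oa; rewrite mul1r /ts_z mulrC divfK ?ts_h_neq0.
  by apply: TM => //; apply: equivariantS; exact: (eqv_h T).
have Tho v : oddz v -> equivariant m.+1 (fun a => h m.+3 (v * a)) by move=> ov; exact: Tshift.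
split=> //.
- move=> v; have [ov|/oddzNP[w ->]] := boolP (oddz v); first exact: Tho.
  apply: (@equivariant_eq _ (fun a => h m.+2 (w * a) ^+ 4)).
    by move=> a _; rewrite -mulrA (ts_h_double ts).
  by apply: equivariantS; apply: (eqvX 4 T); exact: (eqv_h T).
(* 1/h is the conjugate of h divided by the norm; [ts_h_norm] expresses the norm by D and h of level
   [m.+2], which are already inverted. *)
- move=> v ov; apply: (Tshift v (fun a => (h m.+3 a)^-1)) => //.
  apply: (@equivariant_eq _ (fun a => h m.+3 ((1 + 2 ^+ m.+2) * a) *
     (D^-1 ^+ (3 * 4 ^ m.+1) * (h m.+2 ((1 + 2 ^+ m.+1) * a))^-1) ^+ 2)).
    move=> a oa; rewrite -!ts_h_half_mul //.
    have := ts_h_norm m a; have := ts_h_neq0 m.+1 oa.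
    set x := h m.+3 a; set y := h m.+3 _; set w := h m.+2 _ => x0 xy.
    have w0 : w != 0 by rewrite ts_h_neq0 ?oddzD2.
    have D0 : D ^+ (3 * 4 ^ m.+1) != 0 by rewrite expf_neq0.
    by apply: (mulfI x0); rewrite mulrA xy divff // exprVn -exprMn mulrACA !divff // mulr1 expr1n.
  apply: TM; first by apply: Tho; rewrite -[2 ^+ _]mul1r oddz1D2.
  apply: equivariantS; apply: (eqvX 2 T); apply: (eqvM T).
    by apply/equivariant_const/laurentX; exact: laurent_genV.
  by apply: (eqv_hV T); rewrite -[2 ^+ _]mul1r oddz1D2.
Qed.

Lemma equivariantP m : equivariant_theory m.
Proof. by elim: m => [|m]; [exact: equivariant_theory0 | exact: equivariant_theoryS]. Qed.

(* For odd [a] the four shifts in the isogeny relation may be multiplied by   *)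
(* [a], which makes every factor a function of a multiple of [a].             *)
Lemma ts_isogeny_mul m a : oddz a ->
  d m.+3 a * h m.+3 (3 * a) =
    (d m.+2 (- 1 * a) ^+ 4 * h m.+3 a +
     d m.+2 ((- 1 + 2 ^+ m) * a) ^+ 4 * h m.+3 ((1 + 1 * 2 ^+ m.+1) * a) +
     d m.+2 ((- 1 + 2 * 2 ^+ m) * a) ^+ 4 * h m.+3 ((1 + 2 * 2 ^+ m.+1) * a) +
     d m.+2 ((- 1 + 3 * 2 ^+ m) * a) ^+ 4 * h m.+3 ((1 + 3 * 2 ^+ m.+1) * a)) ^+ 4.
Proof.
move=> oa; rewrite -!(ts_d_double ts).
(* c = -2a and e = a give c + 3e = a and e - c = 3a; as c is even, the values of d on the right are
   fourth powers of values of lower level. *)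
have := ts_isogeny ts m.+1 (2 * (- 1 * a)) a.
have -> : 2 * (- 1 * a) + 3 * a = a by ring.
have -> : a - 2 * (- 1 * a) = 3 * a by ring.
move=> ->; congr (_ ^+ 4).
have [[k aE]|[k aE]] := oddz_mod4 oa.
- congr (_ + _ * _ + _ * _ + _ * _).
  + by apply: (@ts_d_eq _ _ _ (- k)); rewrite aE !exprS; ring.
  + by apply: (@ts_h_eq _ _ _ (- k)); rewrite aE !exprS; ring.
  + by apply: (@ts_d_eq _ _ _ (- 2 * k)); rewrite aE !exprS; ring.
  + by apply: (@ts_h_eq _ _ _ (- 2 * k)); rewrite aE !exprS; ring.
  + by apply: (@ts_d_eq _ _ _ (- 3 * k)); rewrite aE !exprS; ring.
  + by apply: (@ts_h_eq _ _ _ (- 3 * k)); rewrite aE !exprS; ring.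
(* For a = -1 modulo 4, multiplication by a exchanges the shifts 1 and 3, so the second and fourth
   terms trade places. *)
- rewrite -!addrA; congr (_ + _).
  rewrite [RHS]addrC [X in _ = X + _]addrC -addrA; congr (_ * _ + (_ * _ + _ * _)).
  + by apply: (@ts_d_eq _ _ _ (1 - 3 * k)); rewrite aE !exprS; ring.
  + by apply: (@ts_h_eq _ _ _ (1 - 3 * k)); rewrite aE !exprS; ring.
  + by apply: (@ts_d_eq _ _ _ (1 - 2 * k)); rewrite aE !exprS; ring.
  + by apply: (@ts_h_eq _ _ _ (1 - 2 * k)); rewrite aE !exprS; ring.
  + by apply: (@ts_d_eq _ _ _ (1 - k)); rewrite aE !exprS; ring.
  + by apply: (@ts_h_eq _ _ _ (1 - k)); rewrite aE !exprS; ring.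
Qed.

(** [ts_isogeny_mul] is solved for d by dividing by the nonzero h(3a); even multipliers descend one
    level by doubling. *)
Lemma equivariant_d m (v : int) : equivariant m (fun a => d m.+2 (v * a)).
Proof.
elim: m v => [|m IH] v; have [ov|/oddzNP[w ->]] := boolP (oddz v).
- exists D; first exact: laurent_gen.
  by move=> a oa; rewrite ts_d2_odd ?oddzM.
- by exists 0; [exact: laurent0 | move=> a _; rewrite -mulrA ts_d2_even].
- have T := equivariantP m.+1.
  apply: (eqv_shift T (e := fun a => d m.+3 a) ov).
  pose s (j a : int) := d m.+2 ((- 1 + j * 2 ^+ m) * a) ^+ 4 * h m.+3 ((1 + j * 2 ^+ m.+1) * a).
  apply: (@equivariant_eq _ (fun a => (s 0 a + s 1 a + s 2 a + s 3 a) ^+ 4 *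
     (h m.+3 (3 * a))^-1)).
    move=> a oa; apply: (mulIf (_ : h m.+3 (3 * a) != 0)); first by rewrite ts_h_neq0 ?oddzM.
    rewrite divfK ?ts_h_neq0 ?oddzM // ts_isogeny_mul // /s.
    by rewrite !mul0r !addr0 !mul1r.
  apply: (eqvM T); last exact: (eqv_hV T).
  apply: (eqvX 4 T).
  have Es j : equivariant m.+1 (s j).
    apply: (eqvM T); last exact: (eqv_h T).
    by apply: (eqvX 4 T); apply: equivariantS.
  by do 3!apply: equivariantD => //.
- apply: (@equivariant_eq _ (fun a => d m.+2 (w * a) ^+ 4)).
    by move=> a _; rewrite -mulrA (ts_d_double ts).
  by apply: equivariantS; apply: (eqvX 4 (equivariantP m)).
Qed.

(** On odd integers e descends to (Z/M)^*/{1, -1} with M = 2^(m+2), because h is even and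
    periodic. *)
Lemma equivariant_reflect m e a k : equivariant m e -> oddz a ->
  e (- a + k * 2 ^+ m.+2) = e a.
Proof.
elim: m e k => [|m IH] e k.
  move=> [x _ ex] oa; rewrite !ex //; case/oddzP: oa => b ->.
  by apply/oddzP; exists (- b - 1 + k * 2); rewrite !exprS; ring.
move=> [al [be [Eal Ebe eE]]] oa.
have ob : oddz (- a + k * 2 ^+ m.+3).
  case/oddzP: oa => b ->.
  by apply/oddzP; exists (- b - 1 + k * 2 ^+ m.+2); rewrite !exprS; ring.
rewrite !eE // /ts_z (@ts_h_eqN m.+3 _ a k) // (@ts_h_eqN m.+2 _ a (2 * k)); last first.
  by rewrite !exprS; ring.
have -> : k * 2 ^+ m.+3 = (2 * k) * 2 ^+ m.+2 by rewrite !exprS; ring.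
by rewrite !IH.
Qed.

Lemma equivariant_trace m e : equivariant m e ->
  laurent_in iota D (\sum_(i < 2 ^ m) e (2 * i%:Z + 1)).
Proof.
have odd2 (i : int) : oddz (2 * i + 1) by apply/oddzP; exists i.
elim: m e => [|m IH] e.
  by move=> [x Lx ex]; rewrite expn0 big_ord1 ex.
move=> [al [be [Eal Ebe eE]]].
rewrite expnS mul2n -addnn big_split_ord /=.
(* Reversing the second half pairs a with b = 2^(m+2) - a, which modulo 2^(m+3) is the opposite of a
   + 2^(m+2). Hence z(b) = z(a) + 1 while al and be agree, and the pair contributes be(a). *)
rewrite [X in _ + X](reindex_inj rev_ord_inj) -big_split /=.
rewrite (eq_bigr (fun i : 'I_(2 ^ m) => be (2 * i%:Z + 1))); first exact: IH.
move=> i _; set a := 2 * _ + 1; set b := 2 * _ + 1.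
have bE : b = - a + 1 * 2 ^+ m.+2.
  rewrite /a /b !exprS; have := ltn_ord i; have : (2 ^ m)%N%:Z = 2 ^+ m :> int by rewrite -natz natrX.
  lia.
have bE2 : b = - (a + 2 ^+ m.+2) + 1 * 2 ^+ m.+3.
  by rewrite bE !exprS; ring.
have oa : oddz a by exact: odd2.
have ob : oddz b by exact: odd2.
have alb : al b = al a by rewrite bE equivariant_reflect.
have beb : be b = be a by rewrite bE equivariant_reflect.
rewrite (eE _ oa) (eE _ ob) alb beb.
have -> : ts_z m b = ts_z m (a + 2 ^+ m.+2).
  rewrite /ts_z bE2 (@ts_h_eqN m.+3 _ (a + 2 ^+ m.+2) 1) //.
  by rewrite (@ts_h_eqN m.+2 _ (a + 2 ^+ m.+2) 2) // !exprS; ring.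
rewrite ts_z_conj //.
by apply: (@ts_eq _ _ (al a + be a * ts_z m a)); ring.
Qed.

(** * Degrees of h and d *)

Local Notation deg_le := (deg_le iota D).

(** h is a root of X^2 + A X + N with A its trace and N its norm. The norm dictates the bound: its
    degree is at most 2(3 * 4^(m+1) + 4^(m+1) - 1) = 2(4^(m+2) - 1). *)
Lemma deg_le_h m a : oddz a -> deg_le (4 ^ m.+1 - 1) (h m.+2 a).
Proof.
elim: m a => [|m IH] a oa; first by rewrite ts_h2_odd //; exact: (deg_le_gen iota D_neq0 3).
pose A := h m.+2 a.
pose N := (D ^+ (3 * 4 ^ m.+1) * h m.+2 (a + 2 ^+ m.+1)) ^+ 2.
pose p : {poly K} := 'X^2 + (A *: 'X + N%:P).
have sA : (size (A *: 'X + N%:P)%R < 3)%N.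
  by rewrite (leq_ltn_trans (size_polyD _ _)) // gtn_max !(leq_ltn_trans (size_scale_leq _ _)) ?size_polyX ?(leq_ltn_trans (size_polyC_leq1 _)).
have sp : size p = 3 by rewrite size_polyDl size_polyXn.
have W : (4 ^ m.+2 = 4 * 4 ^ m.+1)%N by rewrite expnS.
have W0 : (0 < 4 ^ m.+1)%N by rewrite expn_gt0.
apply: (deg_le_root (p := p)).
- by rewrite monicE lead_coefE sp /= !coefE /= mulr0 addr0 addr0.
- apply/rootP; rewrite !hornerE /= /A /N -ts_h_norm ts_h_conj.
  by apply: (@ts_eq _ _ (h m.+3 a ^+ 2 + h m.+2 a * h m.+3 a)); ring.
- rewrite sp /= => -[|[|//]] _; rewrite !coefE /= ?mulr0 ?mulr1 ?add0r ?addr0.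
    apply: (deg_leW (v := ((3 * 4 ^ m.+1 + (4 ^ m.+1 - 1)) * 2)%N)); first by lia.
    apply: deg_leX; apply: deg_leM; first exact: deg_le_gen.
    by apply: IH; exact: oddzD2.
  by apply: deg_leW (IH _ oa) => //; lia.
Qed.

(** For e = 0 the isogeny relation meets h only at quarters of the modulus, where it is 1, a power
    of D, 0 and the same power; the two equal terms merge into a value of d one level down. *)
Lemma ts_d_quartic m a : d m.+3 a * h m.+3 a =
  (d m.+3 a + D ^+ (3 * 4 ^ m.+1) * d m.+2 (a + 2 ^+ m.+1)) ^+ 4.
Proof.
have := ts_isogeny ts m.+1 a 0; rewrite mulr0 addr0 !add0r (ts_h_opp ts) => ->.
congr (_ ^+ 4); rewrite ts_h_zero mulr1 -!addrA; congr (_ + _).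
have -> : 2 * 2 ^+ m.+1 = 2 ^+ m.+2 :> int by rewrite [RHS]exprS.
rewrite ts_h_half mulr0 add0r.
have -> : h m.+3 (3 * 2 ^+ m.+1) = h m.+3 (2 ^+ m.+1).
  by apply: (@ts_h_eqN _ _ _ 1); rewrite !exprS; ring.
rewrite ts_h_quarter -mulrDl mulrC (ts_d_split ts m.+2); congr (_ * (_ + d _ _)).
by rewrite !exprS; ring.
Qed.

(** As for h, now with X^4 + H X + N and N of degree at most 4(3 * 4^(m+1) + 4^(m+1) - 3) =
    4(4^(m+2) - 3). The 3 comes from the base case, where d = D has degree 1 = 4 - 3. *)
Lemma deg_le_d m a : oddz a -> deg_le (4 ^ m.+1 - 3) (d m.+2 a).
Proof.
elim: m a => [|m IH] a oa; first by rewrite ts_d2_odd //; exact: (deg_le_gen iota D_neq0 1).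
pose H := h m.+3 a.
pose N := (D ^+ (3 * 4 ^ m.+1) * d m.+2 (a + 2 ^+ m.+1)) ^+ 4.
pose p : {poly K} := 'X^4 + (H *: 'X + N%:P).
have sA : (size (H *: 'X + N%:P)%R < 5)%N.
  by rewrite (leq_ltn_trans (size_polyD _ _)) // gtn_max !(leq_ltn_trans (size_scale_leq _ _)) ?size_polyX ?(leq_ltn_trans (size_polyC_leq1 _)).
have sp : size p = 5 by rewrite size_polyDl size_polyXn.
have W : (4 ^ m.+2 = 4 * 4 ^ m.+1)%N by rewrite expnS.
have W0 : (4 <= 4 ^ m.+1)%N by rewrite expnS leq_pmulr ?expn_gt0.
apply: (deg_le_root (p := p)).
- by rewrite monicE lead_coefE sp /= !coefE /= mulr0 addr0 addr0.
- apply/rootP; rewrite !hornerE /= /H /N [h _ _ * _]mulrC ts_d_quartic.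
  set x := d _ a; set y := _ * d _ _.
  apply: (@ts_eq _ _ (x ^+ 4 + 2 * x ^+ 3 * y + 3 * x ^+ 2 * y ^+ 2 + 2 * x * y ^+ 3 + y ^+ 4)).
  by ring.
- rewrite sp /= => -[|[|[|[|//]]]] _; rewrite !coefE /= ?mulr0 ?mulr1 ?add0r ?addr0.
  + apply: (deg_leW (v := ((3 * 4 ^ m.+1 + (4 ^ m.+1 - 3)) * 4)%N)); first by lia.
    apply: deg_leX; apply: deg_leM; first exact: deg_le_gen.
    by apply: IH; exact: oddzD2.
  + by apply: deg_leW (deg_le_h m.+1 oa) => //; lia.
  + by rewrite /deg_le mul0r; exact: integral0.
  + by rewrite /deg_le mul0r; exact: integral0.
Qed.

Definition theta_sum m Q u : K :=
  \sum_(i < 2 ^ m) d m.+2 (2 * i%:Z + 1) * d m.+2 (u * (2 * i%:Z + 1)) ^+ Q.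

Lemma laurent_theta_sum m Q u : laurent_in iota D (theta_sum m Q u).
Proof.
apply: (@equivariant_trace _ (fun a => d m.+2 a * d m.+2 (u * a) ^+ Q)).
have T := equivariantP m; apply: (eqvM T).
  by apply: equivariant_eq (equivariant_d m 1) => a _; rewrite mul1r.
by apply: (eqvX Q T); exact: equivariant_d.
Qed.

Lemma deg_le_theta_sum m Q u : oddz u -> deg_le ((4 ^ m.+1 - 3) * Q.+1) (theta_sum m Q u).
Proof.
move=> ou; apply: deg_le_sum => i.
have oi : oddz (2 * i%:Z + 1) by apply/oddzP; exists i%:Z.
rewrite mulnS; apply: deg_leM; first exact: deg_le_d.
by apply: deg_leX; apply: deg_le_d; rewrite oddzM.
Qed.

End Tower.

(** * Generating series modulo 2 *)

Lemma F2_addxx (x : 'F_2) : x + x = 0.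
Proof. by rewrite -mulr2n -mulr_natr (pchar_Zp (p := 2)) // mulr0. Qed.

Lemma F2_addb (b c : bool) : (b (+) c)%:R = b%:R + c%:R :> 'F_2.
Proof. by case: b; case: c => //=; rewrite ?addr0 ?add0r // F2_addxx. Qed.

Lemma fps_coefD (R : comNzRingType) (f g : fps R) k : (f + g) k = f k + g k.
Proof. by []. Qed.

Lemma fps_coefM (R : comNzRingType) (f g : fps R) k :
  (f * g) k = \sum_(i < k.+1) f i * g (k - i)%N.
Proof. by []. Qed.

Lemma fps_coef_sum (R : comNzRingType) (I : Type) (r : seq I) (P : pred I)
  (f : I -> fps R) k : (\sum_(i <- r | P i) f i) k = \sum_(i <- r | P i) f i k.
Proof. by elim/big_rec2: _ => // i x y _ <-. Qed.

Lemma fps_F2_addxx (f : fps 'F_2) : f + f = 0.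
Proof. by apply/fpsP => k; rewrite fps_coefD F2_addxx. Qed.

(** Frobenius, applied to the polynomial truncation of f; squaring fixes the coefficients. *)
Lemma fps_sqrE (f : fps 'F_2) k : (f ^+ 2) k = if odd k then 0 else f k./2.
Proof.
have ch2 : 2 \in [pchar {poly 'F_2}] by rewrite pchar_poly pchar_Fp.
rewrite expr2 [LHS](@fps_mul_trunc _ k) // -expr2 -(pFrobenius_autE ch2).
rewrite /fps_trunc poly_def rmorph_sum /= coef_sum.
transitivity (\sum_(i < k.+1) if (i.*2 == k)%N then f i else 0).
  apply: eq_bigr => i _; rewrite pFrobenius_autE exprZn coefZ -exprM coefXn muln2 eq_sym.
  case: eqP => _; rewrite ?mulr0 // mulr1.
  by case: (f i) => -[|[|]] // lt2; apply/val_inj.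
case: ifPn => [ok|ek].
  by rewrite big1 // => i _; case: eqP => // ik; rewrite -ik odd_double in ok.
have kE : k = k./2.*2 by rewrite -[LHS]odd_double_half (negPf ek).
have lt : (k./2 < k.+1)%N by rewrite {2}kE -addnn ltnS leq_addr.
rewrite (bigD1 (Ordinal lt)) //= -kE eqxx big1 ?addr0 // => i /eqP ik.
by case: eqP => // ik2; case: ik; apply/val_inj; rewrite /= -[LHS]doubleK ik2.
Qed.

(** Stated with an inequality so that one list serves all coefficients that enter a Cauchy
    product. *)
Definition proper_weight (T : eqType) (w : T -> nat) : Prop :=
  forall k, exists s : seq T, forall x, (w x <= k)%N -> x \in s.

Section GeneratingSeries.
Variable T : choiceType.
Implicit Types (P Q : pred T) (w : T -> nat).

(** A sum with infinite support has the default value 0; [proper_weight] excludes this. *)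
Definition gser P w : fps 'F_2 := Fps (fun k => \sum_(x \in [set x | w x = k]) ((P x)%:R : 'F_2)).

Lemma finite_fiber w k : proper_weight w -> finite_set [set x | w x = k].
Proof.
move=> /(_ k)[s sP]; apply: (sub_finite_set _ (finite_seq s)).
by move=> x /= wx; apply: sP; rewrite wx.
Qed.

Lemma gserE P w k (s : seq T) : uniq s -> (forall x, w x = k -> x \in s) ->
  gser P w k = \sum_(x <- s | w x == k) (P x)%:R.
Proof.
move=> us sP.
have fin : finite_set [set x | w x = k].
  by apply: (sub_finite_set _ (finite_seq s)) => x /= /sP.
rewrite /= fsbig_finite //= -[RHS]big_filter; apply: perm_big.
apply: uniq_perm; rewrite ?fset_uniq ?filter_uniq // => x.
rewrite in_fset_set // mem_filter; apply/idP/andP => [|[/eqP wx _]]; last by rewrite inE.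
by rewrite inE /= => wx; rewrite wx eqxx sP.
Qed.

Lemma proper_uniq w k : proper_weight w ->
  exists2 s : seq T, uniq s & forall x, (w x <= k)%N -> x \in s.
Proof.
by move=> /(_ k)[s sP]; exists (undup s); rewrite ?undup_uniq // => x /sP; rewrite mem_undup.
Qed.

Lemma gser_card P w k : proper_weight w ->
  gser P w k = (#|` fset_set [set x | P x /\ w x = k]|)%fset%:R.
Proof.
move=> pw; have [s us sP] := proper_uniq k pw.
rewrite (gserE _ us) //; last by move=> x wx; rewrite sP ?wx.
have fin : finite_set [set x | P x /\ w x = k].
  by apply: (sub_finite_set _ (finite_fiber k pw)) => x [].
rewrite -sum1_size natr_sum; transitivity (\sum_(x <- [seq x <- s | P x && (w x == k)]) (1 : 'F_2)).
  by rewrite big_filter big_mkcondl; apply: eq_bigr => x _; case: (P x).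
apply: perm_big; apply: uniq_perm; rewrite ?fset_uniq ?filter_uniq // => x.
rewrite in_fset_set // mem_filter; apply/idP/idP => [/andP[/andP[Px /eqP wx] _]|].
  by rewrite inE.
by rewrite inE => -[Px wx]; rewrite Px wx eqxx sP ?wx.
Qed.

Lemma eq_gser P Q w : P =1 Q -> gser P w = gser Q w.
Proof. by move=> PQ; apply/fpsP => k /=; apply: eq_fsbigr => x _; rewrite PQ. Qed.

Lemma eq_gserw P w v : w =1 v -> gser P w = gser P v.
Proof. by move=> wv; congr gser; apply/funext. Qed.

(** Modulo 2, indicator functions add by exclusive or. *)
Lemma gserD P Q R w : proper_weight w -> (forall x, R x = P x (+) Q x) ->
  gser R w = gser P w + gser Q w.
Proof.
move=> pw RPQ; apply/fpsP => k; have [s us sP] := proper_uniq k pw.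
have sP' x : w x = k -> x \in s by move=> wx; rewrite sP ?wx.
rewrite fps_coefD !(gserE _ us) // -big_split; apply: eq_bigr => x _.
by rewrite RPQ F2_addb.
Qed.

Lemma gser_sqr P w : proper_weight w -> gser P w ^+ 2 = gser P (fun x => 2 * w x)%N.
Proof.
move=> pw; apply/fpsP => k; rewrite fps_sqrE; have [s us sP] := proper_uniq k pw.
rewrite [RHS](gserE _ us) //; last by move=> x wx; rewrite sP // -wx mul2n -addnn leq_addr.
case: ifPn => [ok|ek].
  by rewrite big1 // => x /eqP wx; rewrite -wx mul2n odd_double in ok.
have kE : k = k./2.*2 by rewrite -[LHS]odd_double_half (negPf ek).
rewrite (gserE _ us) //; last first.
  by move=> x wx; rewrite sP // wx {2}kE -addnn leq_addr.
by apply: eq_bigl => x; rewrite {2}kE mul2n (inj_eq double_inj).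
Qed.

Lemma proper_mulw w c : (0 < c)%N -> proper_weight w -> proper_weight (fun x => c * w x)%N.
Proof.
move=> c0 pw k; have [s sP] := pw k; exists s => x wx; apply: sP.
by rewrite (leq_trans _ wx) // leq_pmull.
Qed.

Lemma gser_pow2 P w n : proper_weight w ->
  gser P w ^+ (2 ^ n) = gser P (fun x => 2 ^ n * w x)%N.
Proof.
move=> pw; elim: n => [|n IH]; first by rewrite expr1; apply: eq_gserw => x; rewrite mul1n.
rewrite expnSr exprM IH gser_sqr; last by apply: proper_mulw => //; rewrite expn_gt0.
by apply: eq_gserw => x; rewrite mulnA -expnS expnSr.
Qed.

End GeneratingSeries.

Lemma proper_pair (T U : eqType) (w : T -> nat) (v : U -> nat) :
  proper_weight w -> proper_weight v ->
  proper_weight (fun p : T * U => w p.1 + v p.2)%N.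
Proof.
move=> pw pv k; have [s sP] := pw k; have [t tP] := pv k.
exists [seq (x, y) | x <- s, y <- t] => -[x y] /= wv; apply/allpairsP; exists (x, y).
by split=> //=; [apply: sP | apply: tP]; rewrite (leq_trans _ wv) ?leq_addr ?leq_addl.
Qed.

Lemma gserM (T U : choiceType) (P : pred T) (Q : pred U) w v :
  proper_weight w -> proper_weight v ->
  gser P w * gser Q v = gser (fun p => P p.1 && Q p.2) (fun p => w p.1 + v p.2)%N.
Proof.
move=> pw pv; apply/fpsP => k; rewrite fps_coefM.
have [s us sP] := proper_uniq k pw; have [t ut tP] := proper_uniq k pv.
have ust : uniq [seq (x, y) | x <- s, y <- t] by apply: allpairs_uniq => // -[x y] [x' y'].
rewrite [RHS](gserE _ ust); last first.
  move=> [x y] /= wv; apply/allpairsP; exists (x, y).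
  by split=> //=; [apply: sP | apply: tP]; rewrite -wv ?leq_addr ?leq_addl.
rewrite [RHS]big_mkcond big_allpairs.
transitivity (\sum_(i < k.+1) \sum_(x <- s) if w x == i then \sum_(y <- t)
    (if (w x + v y == k)%N then (P x && Q y)%:R else 0 : 'F_2) else 0).
  apply: eq_bigr => i _; have ik : (i <= k)%N by rewrite -ltnS.
  rewrite (gserE _ us) //; last by move=> x wx; rewrite sP ?wx.
  rewrite (gserE _ ut) //; last by move=> y vy; rewrite tP ?vy ?leq_subr.
  rewrite big_distrl /= big_mkcond; apply: eq_bigr => x _; case: eqP => // wx.
  rewrite big_distrr /= big_mkcond.
  apply: eq_bigr => y _; rewrite wx.
  have -> : (i + v y == k)%N = (v y == k - i)%N by apply/eqP/eqP; lia.
  by case: ifP => // _; rewrite -natrM mulnb.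
rewrite exchange_big; apply: eq_bigr => x _ /=.
have [wk|wk] := leqP (w x) k.
  have lt : (w x < k.+1)%N by [].
  rewrite (bigD1 (Ordinal lt)) //= eqxx [X in _ + X]big1 ?addr0 // => i /eqP ik.
  by case: eqP => // wi; case: ik; apply/val_inj.
rewrite [LHS]big1 => [|i _]; last by case: eqP => // wi; move: wk; rewrite wi ltnNge -ltnS ltn_ord.
by rewrite big1 // => y _; case: eqP => // wv; move: wk; rewrite -wv ltnNge leq_addr.
Qed.

Lemma gser_bij (T U : choiceType) (f : T -> U) (P : pred T) (Q : pred U) w v :
    proper_weight w -> proper_weight v ->
    (forall x, P x -> Q (f x) /\ v (f x) = w x) ->
    (forall y, Q y -> exists2 x, P x & f x = y) ->
    (forall x x', P x -> P x' -> f x = f x' -> x = x') ->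
  gser P w = gser Q v.
Proof.
move=> pw pv fP fQ fI; apply/fpsP => k.
have [s us sP] := proper_uniq k pw; have [t ut tP] := proper_uniq k pv.
rewrite (gserE _ us) //; last by move=> x wx; rewrite sP ?wx.
rewrite (gserE _ ut) //; last by move=> x wx; rewrite tP ?wx.
have cond (V : choiceType) (r : seq V) (R : pred V) (u : V -> nat) :
    \sum_(x <- r | u x == k) (R x)%:R = \sum_(x <- [seq x <- r | R x && (u x == k)]) 1 :> 'F_2.
  by rewrite big_filter big_mkcondl; apply: eq_bigr => x _; case: (R x).
rewrite !cond -[in LHS](big_map f predT (fun=> 1)); apply: perm_big; apply: uniq_perm.
- rewrite map_inj_in_uniq ?filter_uniq // => x x'; rewrite !mem_filter.
  by move=> /andP[/andP[Px _] _] /andP[/andP[Px' _] _]; exact: fI.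
- by rewrite filter_uniq.
move=> y; rewrite mem_filter; apply/mapP/idP => [[x]|].
  rewrite mem_filter => /andP[/andP[/fP[Qf vf] /eqP wx] _] ->.
  by rewrite Qf vf wx eqxx tP ?vf ?wx.
move=> /andP[/andP[/fQ[x Px <-] /eqP vf] _]; have [_ vw] := fP x Px.
by exists x => //; rewrite mem_filter Px -vw vf eqxx sP // -vw vf.
Qed.

Lemma gser0 (T : choiceType) (P : pred T) w : (forall x, ~~ P x) -> gser P w = 0.
Proof.
move=> P0; apply/fpsP => k /=; apply: fsbig1 => x _.
by rewrite (negPf (P0 x)).
Qed.

(** S picks one point from each orbit of f on P, so f has no fixed point there and every orbit
    counts twice. *)
Lemma gser_cancel (T : choiceType) (f : T -> T) (S P : pred T) w : proper_weight w ->
    involutive f ->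
    (forall x, P x -> [/\ P (f x), w (f x) = w x & S (f x) = ~~ S x]) ->
  gser P w = 0.
Proof.
move=> pw fK fP.
rewrite (gserD (P := fun x => P x && S x) (Q := fun x => P x && ~~ S x)) //; last first.
  by move=> x; case: (P x); case: (S x).
rewrite [X in X + _](@gser_bij _ _ f _ (fun x => P x && ~~ S x) w w) ?fps_F2_addxx //.
- by move=> x /andP[/fP[Pf wf Sf] Sx]; rewrite Pf Sf Sx.
- move=> y /andP[/fP[Pf wf Sf] Sy]; exists (f y); rewrite ?fK //.
  by rewrite Pf Sf Sy.
- by move=> x x' _ _; exact: (can_inj fK).
Qed.

Lemma p32_gser (T : choiceType) (P : pred T) w :
  p32 (gser P w) = gser (fun x => P x && (w x %% 3 == 2)%N) w.
Proof.
apply/fpsP => k /=; case: ifPn => k3.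
  by apply: eq_fsbigr => x; rewrite inE /= => ->; rewrite k3 andbT.
rewrite fsbig1 // => x /= ->.
by rewrite (negPf k3) andbF.
Qed.

(** * Theta series *)

Section FpsDomain.
Variable F : idomainType.
Implicit Types f g : fps F.

(** The unit ring structure, with inverses chosen classically, leads to the integral domain whose
    fraction field carries the tower. *)
Definition fps_unit : pred (fps F) := fun f => `[< exists g, g * f = 1 >].
Definition fps_inv f : fps F :=
  if pselect (exists g, g * f = 1) is left ex then projT1 (cid ex) else f.

Fact fps_mulVr : {in fps_unit, left_inverse 1 fps_inv *%R}.
Proof.
move=> f /asboolP ex; rewrite /fps_inv; case: pselect => // ex'.
by case: (cid ex').
Qed.

Fact fps_unitP f g : g * f = 1 -> fps_unit f.
Proof. by move=> gf; apply/asboolP; exists g. Qed.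

Fact fps_inv_out : {in [predC fps_unit], fps_inv =1 id}.
Proof.
move=> f; rewrite inE /= => /asboolPn nex; rewrite /fps_inv.
by case: pselect.
Qed.

HB.instance Definition _ :=
  GRing.ComNzRing_hasMulInverse.Build (fps F) fps_mulVr fps_unitP fps_inv_out.

Lemma fps_order f : f != 0 -> exists2 k, f k != 0 & forall i, (i < k)%N -> f i = 0.
Proof.
move=> f0; have ex : exists k, f k != 0.
  apply: contrapT => nex; move/eqP: f0; apply; apply/fpsP => k.
  by apply/eqP; apply: contrapT => /negP fk; apply: nex; exists k.
case: (ex_minnP ex) => k fk km; exists k => // i ik.
by apply/eqP; apply: contraTT ik => fi; rewrite -leqNgt km.
Qed.

Lemma fps_coefM_low f g k l :
    (forall i, (i < k)%N -> f i = 0) -> (forall i, (i < l)%N -> g i = 0) ->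
  (f * g) (k + l)%N = f k * g l.
Proof.
move=> fk gl; rewrite fps_coefM.
have lt : (k < (k + l).+1)%N by rewrite ltnS leq_addr.
rewrite (bigD1 (Ordinal lt)) //= addKn big1 ?addr0 // => i /eqP ik.
have [lik|] := ltnP i k; first by rewrite fk ?mul0r.
rewrite leq_eqVlt => /orP[/eqP ki|lki]; first by case: ik; apply/val_inj.
by rewrite gl ?mulr0 //; have := ltn_ord i; lia.
Qed.

Fact fps_integral f g : f * g = 0 -> (f == 0) || (g == 0).
Proof.
move=> fg; apply: contrapT => /negP/norP[/fps_order[k fk kmin] /fps_order[l gl lmin]].
have := fps_coefM_low kmin lmin; rewrite fg => /esym/eqP.
by rewrite mulf_eq0 (negPf fk) (negPf gl).
Qed.

HB.instance Definition _ := GRing.ComUnitRing_isIntegral.Build (fps F) fps_integral.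

End FpsDomain.

Lemma proper_quad s : (0 < s)%N -> proper_weight (fun n : int => s * `|n| ^ 2)%N.
Proof.
move=> s0 k; exists ([seq Posz i | i <- iota 0 k.+1] ++ [seq - Posz i | i <- iota 0 k.+1]).
move=> n nk; have nk' : (`|n| <= k)%N.
  apply: leq_trans nk; rewrite (leq_trans _ (leq_pmull _ s0)) //.
  by rewrite -mulnn; case: `|n|%N => // j; rewrite leq_pmulr.
rewrite mem_cat; apply/orP; case: n nk nk' => j _ jk; [left|right]; apply/mapP.
  by exists j => //; rewrite mem_iota.
by exists j.+1; rewrite ?mem_iota ?NegzE.
Qed.

Lemma two_exp_neq0 m : 2 ^+ m != 0 :> int.
Proof. by rewrite expf_neq0. Qed.

Lemma dvdz_subP (d x c : int) : reflect (exists q, x = c + q * d) (d %| x - c)%Z.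
Proof.
apply: (iffP idP) => [/dvdzP[q qE]|[q ->]]; first by exists q; rewrite -qE; ring.
by apply/dvdzP; exists q; ring.
Qed.

Lemma dvdz_shift4 (t : int) (i j k : int) : t != 0 ->
  ((4 * t) %| (i * t + k * (4 * t)) - j * t)%Z = (4 %| i - j)%Z.
Proof.
move=> t0; have -> : i * t + k * (4 * t) - j * t = (i - j + k * 4) * t by ring.
by rewrite dvdz_mul2r // rpredDr // dvdz_mull.
Qed.

Lemma dvdz_shift2 (t : int) (i j k : int) : t != 0 ->
  ((2 * t) %| (i * t + k * (2 * t)) - j * t)%Z = (2 %| i - j)%Z.
Proof.
move=> t0; have -> : i * t + k * (2 * t) - j * t = (i - j + k * 2) * t by ring.
by rewrite dvdz_mul2r // rpredDr // dvdz_mull.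
Qed.

Section ThetaSeries.
Variables (s : nat) (c : pred int).
Hypothesis s_gt0 : (0 < s)%N.
Hypothesis c_opp : forall n, c (- n) = c n.
Hypothesis c_double : forall n, c (2 * n) = c n.

Definition theta_cls (m : nat) (a n : int) : bool := (2 ^+ m %| n - a)%Z && c n.

Definition theta_ser m a : fps 'F_2 := gser (theta_cls m a) (fun n : int => s * `|n| ^ 2)%N.

Let pw := proper_quad s_gt0.

Lemma theta_ser_per m a k : theta_ser m (a + k * 2 ^+ m) = theta_ser m a.
Proof.
apply: eq_gser => n; rewrite /theta_cls; congr (_ && _).
by rewrite opprD addrA rpredBr // dvdz_mull.
Qed.

Lemma theta_ser_opp m a : theta_ser m (- a) = theta_ser m a.
Proof.
have cls n : theta_cls m a (- n) = theta_cls m (- a) n.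
  by rewrite /theta_cls c_opp -rpredN; congr ((_ %| _)%Z && _); ring.
apply: (@gser_bij _ _ (fun n : int => - n)) => //.
- by move=> n; rewrite cls abszN.
- by move=> n nP; exists (- n); rewrite ?opprK // -cls opprK.
- by move=> n n' _ _ /oppr_inj.
Qed.

Lemma theta_ser_split m a : theta_ser m a = theta_ser m.+1 a + theta_ser m.+1 (a + 2 ^+ m).
Proof.
apply: gserD => // n; rewrite /theta_cls exprS; case: (c n); rewrite ?andbF ?andbT //.
have t0 := two_exp_neq0 m; move: (2 ^+ m : int) t0 => t t0; rewrite opprD addrA.
move: (n - a) => z; have [/dvdzP[q ->]|ndv] := boolP (t %| z)%Z; last first.
  have dv2 : (t %| 2 * t)%Z by rewrite dvdz_mull.
  rewrite (negPf (contra (dvdz_trans dv2) ndv)).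
  by rewrite (negPf (contra (dvdz_trans dv2) _)) // rpredBr.
have -> : q * t = (q %% 2)%Z * t + (q %/ 2)%Z * (2 * t) by rewrite {1}(divz_eq q 2); ring.
have := dvdz_shift2 (q %% 2)%Z 0 (q %/ 2)%Z t0; rewrite mul0r !subr0 => ->.
have := dvdz_shift2 (q %% 2)%Z 1 (q %/ 2)%Z t0; rewrite mul1r => ->.
have [->|->] // : (q %% 2)%Z = 0 \/ (q %% 2)%Z = 1 by lia.
Qed.

Lemma theta_ser_double m a : theta_ser m.+1 (2 * a) = theta_ser m a ^+ 4.
Proof.
rewrite (gser_pow2 _ 2) //; apply/esym.
have cls n : theta_cls m.+1 (2 * a) (2 * n) = theta_cls m a n.
  by rewrite /theta_cls c_double exprS -mulrBr dvdz_mul2l.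
apply: (@gser_bij _ _ (fun n : int => 2 * n)) => //.
- exact: proper_mulw.
- by move=> n nP; rewrite cls; split=> //; rewrite abszM expnMn mulnCA.
- move=> n nP; suff [k kE] : exists k, n = 2 * k by exists k; rewrite // -cls -kE.
  case/andP: nP; rewrite exprS => /dvdzP[q nE] _; exists (q * 2 ^+ m + a).
  by rewrite -[n](subrK (2 * a)) nE; ring.
- by move=> n n' _ _ /mulfI; exact.
Qed.

Lemma theta_ser0_cancel : ~~ c 0 -> theta_ser 0 0 = 0.
Proof.
move=> c0; apply: (@gser_cancel _ (fun n : int => - n) (fun n => 0 < n)) => //.
  by move=> n; rewrite opprK.
move=> n; rewrite /theta_cls !dvd1z /= c_opp abszN => cn; split=> //.
have : n != 0 by apply: contraNneq c0 => <-.
lia.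
Qed.

Lemma theta_ser0_one : (forall n, c n) -> theta_ser 0 0 = 1.
Proof.
move=> cT; rewrite /theta_ser (gserD (P := fun n => n != 0) (Q := fun n => n == 0)) //; last first.
  by move=> n; rewrite /theta_cls dvd1z cT; case: eqP.
rewrite (@gser_cancel _ (fun n : int => - n) (fun n => 0 < n)) //; first last.
- by move=> n n0; rewrite oppr_eq0 n0 abszN; split=> //; lia.
- by move=> n; rewrite opprK.
rewrite add0r; apply/fpsP => k.
rewrite gser_card //; have [->|k0] := posnP k.
  have -> : [set x : int | x == 0 /\ (s * `|x| ^ 2)%N = 0%N] = [set 0].
    by apply/seteqP; split=> x /= => [[/eqP]|->] //; rewrite absz0 muln0.
  by rewrite fset_set1 cardfs1.
have -> : [set x : int | x == 0 /\ (s * `|x| ^ 2)%N = k] = set0.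
  apply/seteqP; split=> x //= [/eqP ->]; rewrite absz0 muln0 => k0'.
  by rewrite -k0' in k0.
by rewrite fset_set0 cardfs0 /=; case: k k0.
Qed.

End ThetaSeries.

Definition is_3unit : pred int := fun n => ~~ (3 %| n)%Z.
Definition hser := theta_ser 3 predT.
Definition dser := theta_ser 1 is_3unit.

Lemma is_3unitN n : is_3unit (- n) = is_3unit n.
Proof. by rewrite /is_3unit; lia. Qed.

Lemma is_3unit_double n : is_3unit (2 * n) = is_3unit n.
Proof. by rewrite /is_3unit; lia. Qed.

Lemma Posz_absz_sqr (n : int) : Posz (`|n| ^ 2)%N = n ^+ 2.
Proof. by rewrite -mulnn PoszM !abszE -expr2 Num.Theory.real_normK ?Num.Theory.num_real. Qed.

(** (x, y) -> (x - y, x + y) doubles x^2 + y^2. With t = 2^m, the pairs sent to the classes of c - e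
    and c + e modulo 2t are those with x - c and y - e both 0 or both t modulo 2t: the two terms on
    the right. *)
Lemma hser_riemann m c e : hser m.+1 (c - e) * hser m.+1 (c + e) =
  (hser m.+1 c * hser m.+1 e + hser m.+1 (c + 2 ^+ m) * hser m.+1 (e + 2 ^+ m)) ^+ 2.
Proof.
have pw : proper_weight (fun n : int => 3 * `|n| ^ 2)%N by exact: proper_quad.
have pp := proper_pair pw pw.
rewrite /hser /theta_ser !gserM // -(gserD (R := fun p : int * int =>
  (theta_cls predT m.+1 c p.1 && theta_cls predT m.+1 e p.2) (+)
  (theta_cls predT m.+1 (c + 2 ^+ m) p.1 && theta_cls predT m.+1 (e + 2 ^+ m) p.2))) //.
rewrite gser_sqr //; apply/esym; have t0 := two_exp_neq0 m.
rewrite /theta_cls exprS; move: (2 ^+ m : int) t0 => t t0.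
apply: (@gser_bij _ _ (fun p : int * int => (p.1 - p.2, p.1 + p.2))) => //.
- exact: proper_mulw.
- move=> [x y] /=; rewrite !andbT => xy; split.
    have [/andP[/dvdz_subP[i ->] /dvdz_subP[j ->]]|/andP[/dvdz_subP[i ->] /dvdz_subP[j ->]]] :
       (2 * t %| x - c)%Z && (2 * t %| y - e)%Z \/
       (2 * t %| x - (c + t))%Z && (2 * t %| y - (e + t))%Z.
      by move: xy; do 2 case: (_ && _) => //; auto.
    + by apply/andP; split; apply/dvdz_subP; [exists (i - j)|exists (i + j)]; ring.
    + by apply/andP; split; apply/dvdz_subP; [exists (i - j)|exists (i + j + 1)]; ring.
  by apply/eqP; rewrite -eqz_nat !(PoszD, PoszM 2, PoszM 3) !Posz_absz_sqr; apply/eqP; ring.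
- move=> [x y] /=; rewrite !andbT => /andP[/dvdz_subP[i ->] /dvdz_subP[j ->]].
  (* r tells to which of the two terms the preimage belongs. *)
  pose r := ((i + j) %% 2)%Z; pose k := ((i + j) %/ 2)%Z.
  have ij : i + j = r + k * 2 by rewrite [RHS]addrC; exact: divz_eq.
  have ji : j - i = r + k * 2 - 2 * i by rewrite -ij; ring.
  exists (c + (i + j) * t, e + (j - i) * t) => /=; last first.
    by congr pair; ring.
  rewrite !andbT.
  have -> : c + (i + j) * t - c = r * t + k * (2 * t) - 0 * t by rewrite ij; ring.
  have -> : e + (j - i) * t - e = r * t + (k - i) * (2 * t) - 0 * t.
    by rewrite ji; ring.
  have -> : c + (i + j) * t - (c + t) = r * t + k * (2 * t) - 1 * t by rewrite ij; ring.
  have -> : e + (j - i) * t - (e + t) = r * t + (k - i) * (2 * t) - 1 * t.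
    by rewrite ji; ring.
  rewrite !dvdz_shift2 //; have [->|->] // : r = 0 \/ r = 1 by rewrite /r; lia.
- by move=> [x y] [x' y'] _ _ /= [xy xy']; congr pair; lia.
Qed.

(** (x, y) -> (x + 3y, y - x) multiplies x^2 + 3y^2 by 4 and keeps x prime to 3. With t = 2^m, the
    preimages satisfy x - c = y - e = jt modulo 4t for one j among 0, 1, 2, 3. *)
Lemma dser_hser_isogeny m c e : dser m.+2 (c + 3 * e) * hser m.+2 (e - c) =
    (dser m.+2 c * hser m.+2 e +
     dser m.+2 (c + 2 ^+ m) * hser m.+2 (e + 2 ^+ m) +
     dser m.+2 (c + 2 * 2 ^+ m) * hser m.+2 (e + 2 * 2 ^+ m) +
     dser m.+2 (c + 3 * 2 ^+ m) * hser m.+2 (e + 3 * 2 ^+ m)) ^+ 4.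
Proof.
have pw : proper_weight (fun n : int => 3 * `|n| ^ 2)%N by exact: proper_quad.
have pw1 : proper_weight (fun n : int => 1 * `|n| ^ 2)%N by exact: proper_quad.
have pp := proper_pair pw1 pw.
pose t : int := 2 ^+ m; have t0 : t != 0 by exact: two_exp_neq0.
have tE : 2 ^+ m.+2 = 4 * t by rewrite !exprS /t; ring.
pose P (j : int) (p : int * int) := theta_cls is_3unit m.+2 (c + j * t) p.1 &&
  theta_cls predT m.+2 (e + j * t) p.2.
have PE (j : int) : dser m.+2 (c + j * t) * hser m.+2 (e + j * t) =
    gser (P j) (fun p => 1 * `|p.1| ^ 2 + 3 * `|p.2| ^ 2)%N.
  by rewrite /dser /hser /theta_ser gserM.
have -> : dser m.+2 c * hser m.+2 e = dser m.+2 (c + 0 * t) * hser m.+2 (e + 0 * t).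
  by rewrite mul0r !addr0.
have -> : dser m.+2 (c + t) * hser m.+2 (e + t) = dser m.+2 (c + 1 * t) * hser m.+2 (e + 1 * t).
  by rewrite mul1r.
rewrite -/t (PE 0) (PE 1) (PE 2) (PE 3) -(gserD (R := fun p => P 0 p (+) P 1 p)) //.
rewrite -(gserD (R := fun p => P 0 p (+) P 1 p (+) P 2 p)) //.
rewrite -(gserD (R := fun p => P 0 p (+) P 1 p (+) P 2 p (+) P 3 p)) //.
rewrite (gser_pow2 _ 2) // /dser /hser /theta_ser gserM //; apply/esym.
apply: (@gser_bij _ _ (fun p : int * int => (p.1 + 3 * p.2, p.2 - p.1))) => //.
- exact: proper_mulw.
- move=> [x y] xy /=; split; last first.
    by apply/eqP; rewrite -eqz_nat !(PoszD, PoszM 1, PoszM (2 ^ 2)%N, PoszM 3) !Posz_absz_sqr; apply/eqP; ring.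
  have [j] : exists j, P j (x, y).
    move: xy; case P0: (P 0 _); first by exists 0.
    case P1: (P 1 _); first by exists 1.
    case P2: (P 2 _); first by exists 2.
    by case P3: (P 3 _) => //; exists 3.
  rewrite /P /theta_cls /= tE andbT => /andP[/andP[/dvdz_subP[i xE] x3] /dvdz_subP[k yE]].
  apply/andP; split; last by rewrite andbT; apply/dvdz_subP; exists (k - i); rewrite xE yE; ring.
  apply/andP; split; last by move: x3; rewrite /is_3unit rpredDr // dvdz_mulr.
  by apply/dvdz_subP; exists (i + 3 * k + j); rewrite xE yE; ring.
- move=> [x y]; rewrite /theta_cls /= tE andbT.
  move=> /andP[/andP[/dvdz_subP[i xE] x3] /dvdz_subP[k yE]].
  pose r := ((i + k) %% 4)%Z; pose l := ((i + k) %/ 4)%Z.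
  have ik : i + k = r + l * 4 by rewrite [RHS]addrC; exact: divz_eq.
  exists (c + (i - 3 * k) * t, e + (i + k) * t) => /=; last first.
    by rewrite xE yE; congr pair; ring.
  have PrE (j : int) : P j (c + (i - 3 * k) * t, e + (i + k) * t) = (4 %| r - j)%Z.
    rewrite /P /theta_cls /= andbT tE.
    have -> : c + (i - 3 * k) * t - (c + j * t) = r * t + (l - k) * (4 * t) - j * t.
      have -> : i - 3 * k = r + l * 4 - 4 * k by rewrite -ik; ring.
      by ring.
    have -> : e + (i + k) * t - (e + j * t) = r * t + l * (4 * t) - j * t by rewrite ik; ring.
    rewrite !dvdz_shift4 //; suff -> : is_3unit (c + (i - 3 * k) * t) by rewrite andbT andbb.
    move: x3; rewrite xE /is_3unit.
    have -> : c + 3 * e + i * (4 * t) = c + (i - 3 * k) * t + 3 * (e + i * t + k * t) by ring.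
    by rewrite rpredDr // dvdz_mulr.
  rewrite !PrE; have [->|[->|[->|->]]] // : r = 0 \/ r = 1 \/ r = 2 \/ r = 3 by rewrite /r; lia.
- by move=> [x y] [x' y'] _ _ /= [xy xy']; congr pair; lia.
Qed.

Lemma proper_nat_sqr : proper_weight (fun m : nat => m ^ 2)%N.
Proof.
move=> k; exists (iota 0 k.+1) => m mk; rewrite mem_iota /= add0n ltnS.
by apply: leq_trans mk; rewrite -mulnn; case: m => // m; rewrite leq_pmulr.
Qed.

Lemma D_gser_nat : D = gser (fun m : nat => (0 < m)%N && coprime m 6) (fun m => m ^ 2)%N.
Proof.
apply/esym; apply/fpsP => k; rewrite (gserE _ (iota_uniq 0 k.+1)) => [|m mk]; last first.
  by rewrite mem_iota /= add0n ltnS -mk -mulnn; case: m {mk} => // m; rewrite leq_pmulr.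
rewrite -[iota 0 k.+1]/(index_iota 0 k.+1) big_mkord /= [RHS]big_mkcond [LHS]big_mkcond /=.
by apply: eq_bigr => i _; case: (0 < i)%N; case: (coprime i 6); case: (_ == k).
Qed.

Lemma coprime_nat6 (m : nat) : coprime m 6 = odd m && ~~ (3 %| m)%N.
Proof.
by rewrite (_ : 6 = 2 * 3)%N // coprimeMr coprimen2 [coprime m 3]coprime_sym prime_coprime.
Qed.

(** Exactly one of n and -n is 1 modulo 4 when n is odd. *)
Lemma D_gser : D = dser 2 1.
Proof.
rewrite D_gser_nat; apply/esym.
apply: (@gser_bij _ _ absz) => //.
- exact: proper_quad.
- exact: proper_nat_sqr.
- move=> n /andP[n4 n3]; split; last by rewrite mul1n.
  have n0 : (0 < `|n|)%N by rewrite absz_gt0; apply: contraNneq n3 => ->.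
  rewrite n0 coprime_nat6 -/(oddz n) -[(3 %| `|n|)%N]/(3 %| n)%Z -/(is_3unit n) n3 andbT.
  by case/dvdz_subP: n4 => q ->; apply/oddzP; exists (2 * q); rewrite exprS expr1; ring.
- move=> m /andP[m0]; rewrite coprime_nat6 => /andP[om m3].
  have [[k kE]|[k kE]] := oddz_mod4 (om : oddz m).
    by exists m%:Z; rewrite // /theta_cls /is_3unit m3 andbT; apply/dvdz_subP; exists k.
  exists (- m%:Z); rewrite ?abszN // /theta_cls is_3unitN /is_3unit m3 andbT.
  by apply/dvdz_subP; exists (- k); rewrite kE !exprS; ring.
- move=> n n' /andP[/dvdz_subP[q ->] _] /andP[/dvdz_subP[q' ->] _].
  by rewrite !exprS expr0 mulr1; lia.
Qed.

Lemma D_low : D 0 = 0 /\ D 1 = 1.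
Proof.
split; rewrite /= big_mkcond /=; first by rewrite big_ord1.
by rewrite big_ord_recl big_ord1 /= add0r.
Qed.

Lemma D_neq0 : D != 0.
Proof. by apply/eqP => /fpsP/(_ 1%N); have [_ ->] := D_low. Qed.

(** * The theta series in the fraction field of F_2[[x]] *)

Local Notation Kx := {fraction fps 'F_2}.
Local Notation tofrac := (@FracField.tofrac (fps 'F_2)).

Definition fps_const (c : 'F_2) : fps 'F_2 := c *: 1.

Lemma fps_const_zmod : zmod_morphism fps_const.
Proof. by move=> x y; rewrite /fps_const scalerBl. Qed.

Lemma fps_const_monoid : monoid_morphism fps_const.
Proof.
split=> [|x y]; rewrite /fps_const ?scale1r //.
by rewrite -scalerAl mul1r scalerA.
Qed.

HB.instance Definition _ := GRing.isZmodMorphism.Build 'F_2 (fps 'F_2) fps_const fps_const_zmod.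
HB.instance Definition _ := GRing.isMonoidMorphism.Build 'F_2 (fps 'F_2) fps_const fps_const_monoid.

Definition frac_const : {rmorphism 'F_2 -> Kx} := tofrac \o fps_const.

Lemma frac_theta_system :
  theta_system (fun m a => tofrac (hser m a)) (fun m a => tofrac (dser m a)).
Proof.
have d2 := is_3unit_double; have dN := is_3unitN.
split=> [|m a k|m a k|m a|m a|m a|m a|m a|m a||||m c e|m c e].
- by rewrite -tofrac1 -tofracD fps_F2_addxx tofrac0.
- by rewrite /hser theta_ser_per.
- by rewrite /dser theta_ser_per.
- by rewrite /hser theta_ser_opp.
- by rewrite /dser theta_ser_opp.
- by rewrite -tofracD /hser -theta_ser_split.
- by rewrite -tofracD /dser -theta_ser_split.
- by rewrite -tofracXn /hser theta_ser_double.
- by rewrite -tofracXn /dser theta_ser_double.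
- by rewrite /hser theta_ser0_one // tofrac1.
- by rewrite /dser theta_ser0_cancel // tofrac0.
- by rewrite tofrac_eq0 -D_gser D_neq0.
- by rewrite -!tofracM -tofracD -tofracXn hser_riemann.
- by rewrite -!tofracM -!tofracD -tofracXn dser_hser_isogeny.
Qed.

(** The powers of D are triangular in x, so the coefficients of a combination of them can be read
    off one after another. *)
Lemma D_exp_low n : (forall i, (i < n)%N -> (D ^+ n) i = 0) /\ (D ^+ n) n = 1.
Proof.
have [D0 D1] := D_low; elim: n => [|n [IHl IHn]]; first by split.
have Dl i : (i < 1)%N -> D i = 0 by case: i.
rewrite exprS; split=> [i ilt|]; last first.
  by rewrite -[n.+1]add1n (fps_coefM_low Dl IHl) D1 IHn mulr1.
rewrite fps_coefM big1 // => j _; have [->|j0] := posnP j; first by rewrite D0 mul0r.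
by rewrite IHl ?mulr0 //; have := ltn_ord j; lia.
Qed.

Lemma frac_polyE (p : {poly 'F_2}) :
  (map_poly frac_const p).[tofrac D] = tofrac (\sum_(i < size p) p`_i *: D ^+ i).
Proof.
rewrite horner_coef size_map_poly rmorph_sum /=; apply: eq_bigr => i _.
by rewrite coef_map /= /fps_const -tofracXn -tofracM -scalerAl mul1r.
Qed.

Lemma D_combination_low n (c : nat -> 'F_2) k : (k < n)%N ->
  (forall i, (i < k)%N -> c i = 0) -> (\sum_(i < n) c i *: D ^+ i) k = c k.
Proof.
move=> kn ck; rewrite fps_coef_sum (bigD1 (Ordinal kn)) //= (D_exp_low k).2 mulr1.
rewrite big1 ?addr0 // => i /eqP ik; have [lik|] := ltnP i k; first by rewrite ck ?mul0r.
rewrite leq_eqVlt => /orP[/eqP ki|lki]; first by case: ik; apply/val_inj.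
by rewrite (D_exp_low i).1 ?mulr0.
Qed.

Lemma D_transcendental (p : {poly 'F_2}) :
  root (map_poly frac_const p) (tofrac D) -> p = 0.
Proof.
move=> /rootP; rewrite frac_polyE => /eqP; rewrite tofrac_eq0 => /eqP/fpsP sp0.
apply/polyP => k; rewrite coef0; have [kn|] := ltnP k (size p); last exact: nth_default.
elim/ltn_ind: k kn => k IH kn.
by rewrite -(D_combination_low kn) ?sp0 // => i ik; apply: IH (ltn_trans ik kn).
Qed.

(** The degree bounds the exponents of D from above. As f D^N has order at least N in x, its
    expansion starts at D^N, and D^N can be cancelled. *)
Lemma fps_laurent_poly (f : fps 'F_2) w :
    laurent_in frac_const (tofrac D) (tofrac f) ->
    deg_le frac_const (tofrac D) w (tofrac f) ->
  exists c : nat -> 'F_2, f = \sum_(i < w.+1) c i *: D ^+ i.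
Proof.
move=> [N [p fp]] dw; have Df0 : tofrac D != 0 by rewrite tofrac_eq0 D_neq0.
have sp := laurent_size_le Df0 D_transcendental dw fp.
have fE : f * D ^+ N = \sum_(i < (N + w).+1) p`_i *: D ^+ i.
  apply/eqP; rewrite -tofrac_eq tofracM tofracXn fp frac_polyE tofrac_eq; apply/eqP.
  rewrite -[RHS](big_mkord xpredT (fun i => p`_i *: D ^+ i)) (big_cat_nat (leq0n _) sp) /=.
  rewrite big_mkord [X in _ + X]big_nat_cond [X in _ + X]big1 ?addr0 // => i /andP[/andP[si _] _].
  by rewrite nth_default ?scale0r.
have p0 k : (k < N)%N -> p`_k = 0.
  elim/ltn_ind: k => k IH kN.
  have kn : (k < (N + w).+1)%N by rewrite ltnS (leq_trans (ltnW kN)) ?leq_addr.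
  have := @D_combination_low _ (fun i => p`_i) _ kn (fun i ik => IH i ik (ltn_trans ik kN)).
  rewrite -fE => <-; rewrite fps_coefM big1 // => i _.
  by rewrite (D_exp_low N).1 ?mulr0 // (leq_ltn_trans (leq_subr _ _)).
exists (fun i => p`_(N + i)); apply: (mulIf (expf_neq0 N D_neq0)).
rewrite fE -addnS big_split_ord /= big1 ?add0r => [|i _]; last by rewrite p0 ?scale0r.
by rewrite big_distrl /=; apply: eq_bigr => i _; rewrite -scalerAl -exprD addnC.
Qed.

(** * The space W5 *)

Section LinearSpan.
Variables (K : fieldType) (V : lmodType K) (S : set V).

Lemma span_gen v : S v -> linear_span S v.
Proof. by move=> Sv; exists 1%N, (fun=> 1), (fun=> v); rewrite big_ord1 scale1r. Qed.

Lemma span0 : linear_span S 0.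
Proof.
exists 0%N, (fun=> 0), (fun=> 0); rewrite big_ord0; split=> // i.
by case: i.
Qed.

Lemma spanZ a v : linear_span S v -> linear_span S (a *: v).
Proof.
move=> [n [c [u [Su ->]]]]; exists n, (fun i => a * c i), u; split=> //.
by rewrite scaler_sumr; apply: eq_bigr => i _; rewrite scalerA.
Qed.

Lemma spanD v w : linear_span S v -> linear_span S w -> linear_span S (v + w).
Proof.
move=> [n [c [u [Su ->]]]] [n' [c' [u' [Su' ->]]]].
exists (n + n')%N, (fun i => match split i with inl j => c j | inr j => c' j end),
  (fun i => match split i with inl j => u j | inr j => u' j end); split.
  by move=> i; case: (split i).
rewrite big_split_ord /=; congr (_ + _); apply: eq_bigr => i _.
  by rewrite (unsplitK (inl i)).
by rewrite (unsplitK (inr i)).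
Qed.

Lemma span_sum (I : Type) (r : seq I) (P : pred I) (f : I -> V) :
  (forall i, P i -> linear_span S (f i)) -> linear_span S (\sum_(i <- r | P i) f i).
Proof.
by move=> Sf; apply: big_ind => // [|v w]; [exact: span0 | exact: spanD].
Qed.

End LinearSpan.

(** The square of an integer prime to 6 is 1 modulo 6. *)
Lemma D_exp_mod6 n k : (D ^+ n) k != 0 -> (k %% 6 = n %% 6)%N.
Proof.
have D1 j : D j != 0 -> (j %% 6 = 1)%N.
  move=> Dj; have [m m6 <-] : exists2 m : nat, coprime m 6 & (m ^ 2)%N = j.
    apply: contrapT => nex; move/eqP: Dj; apply; rewrite /= big1 // => m /and3P[_ m6 /eqP mj].
    by case: nex; exists m.
  rewrite -modnXm; have : coprime (m %% 6) 6 by rewrite coprime_modl.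
  by have := ltn_pmod m (isT : 0 < 6)%N; case: (m %% 6)%N => [|[|[|[|[|[|]]]]]].
elim: n k => [|n IH] k; first by case: k.
rewrite exprS fps_coefM => Dk.
have [i Di] : exists i : 'I_k.+1, D i * (D ^+ n) (k - i)%N != 0.
  apply: contrapT => nex; move/eqP: Dk; apply; rewrite big1 // => i _.
  by apply/eqP; apply: contrapT => /negP Di; apply: nex; exists i.
move: Di; rewrite mulf_eq0 => /norP[/D1 i1 /IH kin].
have ik : (i <= k)%N by rewrite -ltnS.
by rewrite -(subnKC ik) -modnDm i1 kin modnDmr.
Qed.

Lemma W5_of_expansion q (f : fps 'F_2) n (c : nat -> 'F_2) : (n <= 12 * q ^ 2)%N ->
    (forall k, (k %% 6 != 5)%N -> f k = 0) -> f = \sum_(i < n) c i *: D ^+ i ->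
  W5 q f.
Proof.
move=> nq f5 fE.
have -> : f = \sum_(i < n | (i %% 6 == 5)%N) c i *: D ^+ i.
  apply/fpsP => k; rewrite fps_coef_sum; have [k5|k5] := eqVneq (k %% 6)%N 5; last first.
    rewrite f5 // big1 // => i /eqP i5 /=; have [->|/D_exp_mod6 ki] := eqVneq ((D ^+ i) k) 0.
      by rewrite mulr0.
    by rewrite ki i5 eqxx in k5.
  rewrite fE fps_coef_sum [RHS]big_mkcond; apply: eq_bigr => i _.
  case: eqP => // i5 /=; have [->|/D_exp_mod6 ki] := eqVneq ((D ^+ i) k) 0.
    by rewrite mulr0.
  by case: i5; rewrite -ki.
apply: span_sum => i /eqP i5; apply/spanZ/span_gen; exists i; split=> //.
- by case: (nat_of_ord i) i5.
- exact: leq_trans (ltn_ord i) nq.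
Qed.

Definition dsum m Q u : fps 'F_2 :=
  \sum_(i < 2 ^ m) dser m.+2 (2 * i%:Z + 1) * dser m.+2 (u * (2 * i%:Z + 1)) ^+ Q.

Lemma dsum_expansion m Q u : oddz u ->
  exists c : nat -> 'F_2, dsum m Q u = \sum_(i < ((4 ^ m.+1 - 3) * Q.+1).+1) c i *: D ^+ i.
Proof.
move=> ou; have := deg_le_theta_sum frac_const frac_theta_system m Q ou.
have := laurent_theta_sum frac_const frac_theta_system m Q u.
have -> : theta_sum (fun m a => @FracField.tofrac (fps 'F_2) (dser m a)) m Q u =
    FracField.tofrac (dsum m Q u).
  by rewrite rmorph_sum; apply: eq_bigr => i _ /=; rewrite tofracM tofracXn.
by rewrite -D_gser; exact: fps_laurent_poly.
Qed.

Lemma W5_dsum m i u : oddz u ->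
  (forall k, (k %% 6 != 5)%N -> dsum m (4 ^ i.+1) u k = 0) ->
  W5 (2 ^ (m + i.+1)) (dsum m (4 ^ i.+1) u).
Proof.
move=> ou f5; have [c cE] := dsum_expansion m (4 ^ i.+1) ou.
apply: W5_of_expansion f5 cE.
rewrite -expnM [((m + i.+1) * 2)%N]mulnC expnM -[(2 ^ 2)%N]/4%N expnD !expnS.
have : (0 < 4 ^ m)%N by rewrite expn_gt0.
have : (0 < 4 ^ i)%N by rewrite expn_gt0.
(* With x = 4^m and y = 4^i the claim is (4x - 3)(4y + 1) < 48xy. *)
move: (4 ^ m)%N (4 ^ i)%N => x y; nia.
Qed.

(** * Ideals of Z[i] *)

Lemma card_set_seq (T : choiceType) (S : set T) (s : seq T) : uniq s ->
  (forall x, S x <-> x \in s) -> #|` fset_set S|%fset = size s.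
Proof.
move=> us Ss; have fin : finite_set S.
  by apply: (sub_finite_set _ (finite_seq s)) => x /Ss.
apply/perm_size/uniq_perm; rewrite ?fset_uniq // => x.
by rewrite in_fset_set //; apply/idP/idP; rewrite inE => /Ss.
Qed.

Lemma card_set_bij (T U : choiceType) (f : T -> U) (A : set T) (B : set U) :
    finite_set A -> (forall x, A x -> B (f x)) -> (forall y, B y -> exists2 x, A x & f x = y) ->
    (forall x x', A x -> A x' -> f x = f x' -> x = x') ->
  #|` fset_set B|%fset = #|` fset_set A|%fset.
Proof.
move=> finA fA fB fI; pose s : seq T := fset_set A.
have sA x : (x \in s) <-> A x by rewrite /s in_fset_set // inE.
have us : uniq s by exact: fset_uniq.
rewrite (@card_set_seq _ B (map f s)) ?size_map //.
  by rewrite map_inj_in_uniq // => x x' /sA Ax /sA Ax'; exact: fI.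
move=> y; split=> [/fB[x Ax <-]|/mapP[x /sA Ax ->]]; last exact: fA.
by apply: map_f; apply/sA.
Qed.

Lemma principalP (a b p r : int) : principal (Gint a b) (Gint p r) <->
  exists s t, p = s * a - t * b /\ r = s * b + t * a.
Proof.
split=> [[[s t] [-> ->]]|[s [t [-> ->]]]]; first by exists s, t.
by exists (Gint s t).
Qed.

Lemma principal_ideal z : is_ideal (principal z).
Proof.
split; first by exists 0; rewrite mul0r.
by move=> x _ _ [v ->] [w ->]; exists (x * v + w); ring.
Qed.

Lemma principal_sub z x y : principal z x -> principal z y -> principal z (x - y).
Proof. by move=> [v ->] [w ->]; exists (v - w); ring. Qed.

Lemma principal_add z x y : principal z x -> principal z y -> principal z (x + y).
Proof. by move=> [v ->] [w ->]; exists (v + w); ring. Qed.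

Lemma coset_eq z x y :
  ([set w | principal z (w - x)] = [set w | principal z (w - y)]) <-> principal z (x - y).
Proof.
split=> [/seteqP[sub _]|zxy].
  by apply: (sub x); rewrite /= subrr; exists 0; rewrite mul0r.
apply/seteqP; split=> w /= zw.
  by have := principal_add zw zxy; congr (principal z _); ring.
by have := principal_sub zw zxy; congr (principal z _); ring.
Qed.

Lemma small_residue_eq (n : int) (x y : nat) : 0 < n -> (x < `|n|)%N -> (y < `|n|)%N ->
  (n %| x%:Z - y%:Z)%Z -> x = y.
Proof.
move=> n0 xn yn; rewrite -eqz_mod_dvd => /eqP.
have E (z : nat) : (z < `|n|)%N -> (z%:Z %% n)%Z = z.
  by move=> zn; rewrite modz_small //; lia.
by rewrite !E // => -[].
Qed.

(* Hermite normal form of the lattice (a + b i): with g = gcd(a, b) the      *)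
(* residues are x + y i with 0 <= y < g and 0 <= x < (a^2 + b^2) / g.        *)
Lemma ideal_norm_principal (a b : int) : (a, b) != (0, 0) ->
  ideal_norm (principal (Gint a b)) = (`|a| ^ 2 + `|b| ^ 2)%N.
Proof.
move=> ab0; pose g : int := gcdz a b.
have g0 : g != 0 by rewrite gcdz_eq0 -xpair_eqE.
have gpos : 0 < g by have : 0 <= g by []; lia.
have [a' aE] : exists a', a = a' * g by apply/dvdzP; exact: dvdz_gcdl.
have [b' bE] : exists b', b = b' * g by apply/dvdzP; exact: dvdz_gcdr.
have [u [v uv]] := Bezoutz a b; rewrite -/g in uv.
pose n : int := a' * a + b' * b.
have nE : n * g = a ^+ 2 + b ^+ 2.
  have -> : n * g = a * (a' * g) + b * (b' * g) by rewrite /n; ring.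
  by rewrite -aE -bE; ring.
have npos : 0 < n.
  have : 0 < n * g.
    rewrite nE; move: ab0; rewrite xpair_eqE; have := sqr_ge0 a; have := sqr_ge0 b; nia.
  by rewrite pmulr_lgt0.
have I_im p r : principal (Gint a b) (Gint p r) -> (g %| r)%Z.
  move=> /principalP[s [t [_ ->]]]; rewrite aE bE.
  by rewrite rpredD // !mulrA dvdz_mull.
have I_re p : principal (Gint a b) (Gint p 0) <-> (n %| p)%Z.
  split=> [/principalP[s [t [pE rE]]]|/dvdzP[k ->]].
    apply/dvdzP; exists (u * s - v * t); apply: (mulIf g0).
    rewrite -mulrA nE -[in LHS]uv pE.
    have -> : (s * a - t * b) * (u * a + v * b) =
      (u * s - v * t) * (a ^+ 2 + b ^+ 2) + (v * a - u * b) * (s * b + t * a) by ring.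
    by rewrite -rE mulr0 addr0.
  apply/principalP; exists (k * a'), (- (k * b')); split; first by rewrite /n; ring.
  rewrite [X in _ * X + _]bE [X in _ + _ * X]aE; ring.
(* Multiples of this Bezout element reduce imaginary parts modulo g without leaving the coset. *)
have I_g : principal (Gint a b) (Gint (v * a - u * b) g).
  by apply/principalP; exists v, u; rewrite -uv; split; ring.
pose rep (p : nat * nat) : set gint :=
  [set w | principal (Gint a b) (w - Gint p.1 p.2)].
pose s := [seq (x, y) | x <- iota 0 `|n|, y <- iota 0 `|g|].
have us : uniq s by apply: allpairs_uniq; rewrite ?iota_uniq // => -[x y] [x' y'].
have sP x y : ((x, y) \in s) = (x < `|n|)%N && (y < `|g|)%N.
  apply/allpairsP/andP => [[[x' y'] /= []]|[xn yg]].
    by rewrite !mem_iota /= !add0n => xn yg [-> ->].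
  by exists (x, y); rewrite !mem_iota /= !add0n.
rewrite /ideal_norm (@card_set_seq _ _ (map rep s)) ?size_map.
- rewrite size_allpairs !size_iota; apply/eqP; rewrite -eqz_nat PoszM PoszD.
  by rewrite !Posz_absz_sqr -nE !gez0_abs // ltW.
- rewrite map_inj_in_uniq // => -[x y] [x' y']; rewrite !sP => /andP[xn yg] /andP[xn' yg'].
  move=> /coset_eq /= zxy.
  have yy : y = y' by apply: (@small_residue_eq g) => //; exact: (I_im _ _ zxy).
  subst y'; congr (_, _); apply: (@small_residue_eq n) => //; apply/I_re.
  by move: zxy; congr (principal _ (Gint _ _)); rewrite subrr.
- move=> C; split=> [[[p r] ->]|/mapP[[x y] _ ->]]; last by exists (Gint x y).
  pose k := (r %/ g)%Z; pose p' := p - k * (v * a - u * b); pose l := (p' %/ n)%Z.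
  have rE : r = k * g + (r %% g)%Z by exact: divz_eq.
  have pE : p' = l * n + (p' %% n)%Z by exact: divz_eq.
  have r0 : 0 <= (r %% g)%Z by rewrite modz_ge0.
  have r1 : (r %% g)%Z < g by rewrite ltz_pmod.
  have p0 : 0 <= (p' %% n)%Z by rewrite modz_ge0 // gt_eqF.
  have p1 : (p' %% n)%Z < n by rewrite ltz_pmod.
  apply/mapP; exists (`|(p' %% n)%Z|%N, `|(r %% g)%Z|%N); first by rewrite sP; lia.
  apply/coset_eq; rewrite /= !gez0_abs //.
  have -> : Gint p r - Gint (p' %% n)%Z (r %% g)%Z =
     Gint k 0 * Gint (v * a - u * b) g + Gint (l * n) 0.
    congr Gint => /=; last by rewrite [X in X - _]rE; ring.
    have -> : (p' %% n)%Z = p' - l * n by rewrite [X in _ = X - _]pE; ring.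
    by rewrite /p'; ring.
  apply: (principal_ideal (Gint a b)).2 => //.
  by apply/I_re; rewrite dvdz_mull.
Qed.

Lemma int_mul_eq1 (x y : int) : 0 <= x -> 0 <= y -> x * y = 1 -> y = 1.
Proof.
move=> x0 y0 xy; have /eqP : absz (x * y) = 1%N by rewrite xy.
by rewrite abszM muln_eq1 => /andP[_ /eqP]; lia.
Qed.

Lemma sum_sqr_eq1 (s t : int) : s ^+ 2 + t ^+ 2 = 1 ->
  (s = 0 /\ (t = 1 \/ t = -1)) \/ (t = 0 /\ (s = 1 \/ s = -1)).
Proof.
rewrite !expr2 => st.
have hs : s = 0 \/ s = 1 \/ s = -1 by nia.
have ht : t = 0 \/ t = 1 \/ t = -1 by nia.
by case: hs st => [->|[->|->]]; case: ht => [->|[->|->]]; lia.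
Qed.

(** The generators differ by a factor of norm 1, and i or -i would make the real part even. *)
Lemma principal_normal_inj (a b a' b' : int) : oddz a -> oddz a' ->
  principal (Gint a (2 * b)) = principal (Gint a' (2 * b')) ->
  (a' = a /\ b' = b) \/ (a' = - a /\ b' = - b).
Proof.
move=> oa oa' eqI.
have : principal (Gint a (2 * b)) (Gint a' (2 * b')) by rewrite eqI; exists 1; rewrite mul1r.
have : principal (Gint a' (2 * b')) (Gint a (2 * b)) by rewrite -eqI; exists 1; rewrite mul1r.
move=> /principalP[s [t [aE bE]]] /principalP[s' [t' [aE' bE']]].
have nn (x y c d : int) : (x * c - y * d) ^+ 2 + (x * d + y * c) ^+ 2 =
  (x ^+ 2 + y ^+ 2) * (c ^+ 2 + d ^+ 2) by ring.
have N := nn s t a' (2 * b'); rewrite -aE -bE in N.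
have N' := nn s' t' a (2 * b); rewrite -aE' -bE' in N'.
have Npos : a ^+ 2 + (2 * b) ^+ 2 != 0.
  rewrite paddr_eq0 ?sqr_ge0 // sqrf_eq0; apply/negP => /andP[/eqP a0 _].
  by rewrite a0 in oa.
have : (s ^+ 2 + t ^+ 2) * (s' ^+ 2 + t' ^+ 2) = 1.
  by apply: (mulIf Npos); rewrite mul1r -mulrA -N' -N.
move=> st; have {}st : s' ^+ 2 + t' ^+ 2 = 1.
  by apply: int_mul_eq1 st; rewrite addr_ge0 ?sqr_ge0.
have [[s0 [t1|t1]]|[t0 [s1|s1]]] := sum_sqr_eq1 st.
- by move: oa'; rewrite aE' s0 t1 /oddz; clear; lia.
- by move: oa'; rewrite aE' s0 t1 /oddz; clear; lia.
- by left; split; [rewrite aE' s1 t0; ring | move: bE'; rewrite s1 t0; clear; lia].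
- by right; split; [rewrite aE' s1 t0; ring | move: bE'; rewrite s1 t0; clear; lia].
Qed.

Definition norm_weight (r : nat) (p : int * int) : nat := (`|p.1| ^ 2 + 4 * r ^ 2 * `|p.2| ^ 2)%N.

Lemma proper_norm_weight r : (0 < r)%N -> proper_weight (norm_weight r).
Proof.
move=> r0; have p1 : proper_weight (fun n : int => 1 * `|n| ^ 2)%N by exact: proper_quad.
have p2 : proper_weight (fun n : int => (4 * r ^ 2) * `|n| ^ 2)%N.
  by apply: proper_quad; rewrite muln_gt0 expn_gt0 r0.
move=> k; have [s sP] := proper_pair p1 p2 k; exists s => x wx; apply: sP.
by rewrite mul1n.
Qed.

Lemma ideal_norm_normal (a b : int) (r : nat) : oddz a ->
  ideal_norm (principal (Gint a (2 * (b * r%:Z)))) = norm_weight r (a, b).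
Proof.
move=> oa; rewrite ideal_norm_principal; last first.
  by rewrite xpair_eqE; apply/negP => /andP[/eqP a0 _]; rewrite a0 in oa.
rewrite /norm_weight /= !abszM !expnMn; congr (_ + _)%N.
rewrite -[absz r%:Z]/r -[absz 2]/2%N; ring.
Qed.

(** The condition 0 < p.1 selects one of the two generators of each ideal. *)
Lemma theta_card (C : set (set gint)) (P : pred (int * int)) (r : nat) n : (0 < r)%N ->
    (forall I, C I <-> exists p, P p /\ I = principal (Gint p.1 (2 * (p.2 * r%:Z)))) ->
    (forall p, P p -> (0 < p.1) /\ oddz p.1) ->
  theta C n = #|` fset_set [set p | P p /\ norm_weight r p = n]|%fset%:Z.
Proof.
move=> r0 CP Pp; congr Posz; apply: (@card_set_bij _ _ (fun p => principal (Gint p.1 (2 * (p.2 * r%:Z))))).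
- apply: (sub_finite_set _ (finite_fiber n (proper_norm_weight r0))) => p [] //.
- move=> [a b] [Pab wn]; split; first by apply/CP; exists (a, b).
  by rewrite ideal_norm_normal //; exact: (Pp _ Pab).2.
- move=> I [/CP[[a b] [Pab ->]]]; rewrite ideal_norm_normal; last exact: (Pp _ Pab).2.
  by move=> wn; exists (a, b).
- move=> [a b] [a' b'] [/Pp[a0 oa] _] [/Pp[a0' oa'] _] /= /principal_normal_inj[] // [aE bE].
    by rewrite aE; congr (_, _); apply: (mulIf (_ : r%:Z != 0)); rewrite ?bE //; lia.
  by move: a0 a0'; rewrite /= aE; lia.
Qed.

(** * Gauss-classes *)

Lemma red2_theta (C : set (set gint)) (P : pred (int * int)) (r : nat) : (0 < r)%N ->
    (forall I, C I <-> exists p, P p /\ I = principal (Gint p.1 (2 * (p.2 * r%:Z)))) ->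
    (forall p, P p -> (0 < p.1) /\ oddz p.1) ->
  red2 (theta C) = gser P (norm_weight r).
Proof.
move=> r0 CP Pp; apply/fpsP => n; rewrite gser_card; last exact: proper_norm_weight.
by rewrite -[LHS]/((theta C n)%:~R) (theta_card n r0 CP Pp).
Qed.

(** The congruence is b/a = b0/a0 modulo 2q, cross-multiplied. *)
Definition gauss_pred (q : nat) (a0 b0 : int) (p : int * int) : bool :=
  [&& 0 < p.1, oddz p.1 & ((2 * q)%N%:Z %| a0 * p.2 - b0 * p.1)%Z].

Lemma normal_generatorP I z : normal_generator I z ->
  exists a b, [/\ oddz a, z = Gint a (2 * b) & I = principal (Gint a (2 * b))].
Proof. by move=> [[a [b [oa ->]]] ->]; exists a, b. Qed.

Lemma principal_opp z : principal (- z) = principal z.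
Proof.
apply/seteqP; split=> w [v ->]; exists (- v); first by rewrite mulNr mulrN.
by rewrite mulrNN.
Qed.

Lemma gint_intr (x : int) : x%:~R = Gint x 0 :> gint.
Proof.
have natG (n : nat) : n%:R = Gint n 0 :> gint.
  by elim: n => [|n IH] //; rewrite -natr1 IH -addn1 PoszD.
case: x => n; first by rewrite -pmulrn natG.
by rewrite NegzE mulrNz -pmulrn natG.
Qed.

Lemma gauss_congruenceP q (N a b a' b' : int) :
  (exists v, N%:~R * Gint a (2 * b) = Gint a' (2 * b') + (4 * q)%:R * v) <->
  exists s t : int, N * a = a' + s * (4 * q)%N%:Z /\ N * b = b' + t * (2 * q)%N%:Z.
Proof.
rewrite -[(4 * q)%:R]/((4 * q)%N%:Z%:~R) !gint_intr; split=> [[[s t]]|[s [t [aN bN]]]].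
  case=> re im; exists s, t; split; first by move: re; rewrite !mul0r !subr0 => ->; ring.
  apply: (mulfI (_ : 2 != 0 :> int)) => //.
  move: im; rewrite !mul0r !addr0 mulrCA => ->; rewrite mulrDr; congr (_ + _).
  by rewrite !PoszM; ring.
exists (Gint s t); congr Gint => /=; first by rewrite !mul0r !subr0 aN; ring.
by rewrite !mul0r !addr0 mulrCA bN !PoszM; ring.
Qed.

Lemma gauss_class_theta q C : (exists k, q = 2 ^ k)%N -> gauss_class q C ->
  red2 (theta C) = 0 \/ exists a0 b0, oddz a0 /\
    red2 (theta C) = gser (gauss_pred q a0 b0) (norm_weight 1).
Proof.
move=> [k qE] [I _ ->].
have q0 : (0 < q)%N by rewrite qE expn_gt0.
have [[z0 /normal_generatorP[a0 [b0 [oa0 _ IE]]]]|noI] := pselect (exists z, normal_generator I z); last first.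
  (* An ideal without a normal generator is Gauss-equivalent to no ideal, so its class is empty. *)
  left; rewrite (@red2_theta _ (fun=> false) 1) //; first by rewrite gser0.
  by move=> J; split=> [[_ [z [w [zI _ _]]]]|[p []] //]; case: noI; exists z.
right; exists a0, b0; split=> //; apply: red2_theta => // [J|[a b] /and3P[]] //.
split=> [[_ [z [w [/normal_generatorP[a1 [b1 [oa1 -> IE1]]]]]]]|[[a b] [/and3P[/= apos oa dvd] ->]]].
  move=> /normal_generatorP[a [b [oa -> JE]]] [N /gauss_congruenceP[s [t [aN bN]]]].
  have dvd1 : ((2 * q)%N%:Z %| a1 * b - b1 * a)%Z.
    apply/dvdzP; exists (2 * b1 * s - a1 * t).
    have -> : b = N * b1 - t * (2 * q)%N%:Z by rewrite bN; ring.
    have -> : a = N * a1 - s * (4 * q)%N%:Z by rewrite aN; ring.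
    by rewrite !PoszM; ring.
  have dvd : ((2 * q)%N%:Z %| a0 * b - b0 * a)%Z.
    have := IE; rewrite IE1 => /principal_normal_inj[] // [-> ->] //.
    by rewrite -rpredN; move: dvd1; congr (_ %| _)%Z; ring.
  have [apos|aneg] := ltP 0 a.
    by exists (a, b); rewrite /gauss_pred /= apos oa dvd mulr1.
  exists (- a, - b); rewrite /gauss_pred /= mulr1; split; last first.
    by rewrite JE -principal_opp; congr (principal (Gint _ _)) => /=; ring.
  apply/and3P; split; last by rewrite -rpredN; move: dvd; congr (_ %| _)%Z; ring.
    by move: oa; rewrite /oddz; lia.
  by rewrite /oddz abszN.
have JE : normal_generator (principal (Gint a (2 * (b * 1)))) (Gint a (2 * b)).
  by rewrite mulr1; split=> //; exists a, b.
split.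
  split; first exact: principal_ideal.
  rewrite (ideal_norm_normal b 1 oa) /norm_weight /= -mulnA oddD oddM /= addbF oddX /=.
  exact: oa.
exists (Gint a0 (2 * b0)), (Gint a (2 * b)); split=> //; first by split=> //; exists a0, b0.
have cop n : coprimez a0 (4 * 2 ^ n)%N%:Z.
  by rewrite coprimezE /= coprimeMr coprimeXr ?coprimen2 // (_ : 4 = 2 ^ 2)%N // coprimeXr ?coprimen2.
have [u [v uv]] := Bezoutz a0 (4 * q)%N%:Z.
have {}uv : u * a0 + v * (4 * q)%N%:Z = 1 by rewrite uv qE; exact/eqP/cop.
(* u inverts a0 modulo 4q, which gives the real congruence; the imaginary one is checked after
   multiplication by a0, prime to 2q. *)
exists (a * u); apply/gauss_congruenceP.
have aN : a * u * a0 = a + - (a * v) * (4 * q)%N%:Z.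
  rewrite -mulrA; have -> : u * a0 = 1 - v * (4 * q)%N%:Z by rewrite -uv; ring.
  by ring.
have cop2 : coprimez (2 * q)%N%:Z a0.
  rewrite coprimez_sym; have := cop k; rewrite -qE (_ : 4 * q = 2 * q * 2)%N; last by lia.
  by rewrite !coprimezE /= coprimeMr => /andP[].
have : ((2 * q)%N%:Z %| a * u * b0 - b)%Z.
  rewrite -(Gauss_dvdzr _ cop2).
  have -> : a0 * (a * u * b0 - b) = b0 * (a * u * a0) - a0 * b by ring.
  rewrite aN; have -> : b0 * (a + - (a * v) * (4 * q)%N%:Z) - a0 * b =
     - (a0 * b - b0 * a) - 2 * b0 * a * v * (2 * q)%N%:Z by rewrite !PoszM; ring.
  by rewrite rpredB ?rpredN // dvdz_mull.
by case/dvdz_subP => t bN; exists (- (a * v)), t.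
Qed.

(** * Projected theta series *)

Lemma sqr_mod3 (x : nat) : ((x ^ 2) %% 3 = ~~ (3 %| x))%N.
Proof.
rewrite -modnXm /dvdn; have := ltn_pmod x (isT : 0 < 3)%N.
by case: (x %% 3)%N => [|[|[|]]].
Qed.

Lemma quad_form_mod3 (r x y : nat) : ~~ (3 %| r)%N ->
  ((x ^ 2 + 4 * r ^ 2 * y ^ 2) %% 3 == 2)%N = ~~ (3 %| x)%N && ~~ (3 %| y)%N.
Proof.
move=> r3; rewrite -modnDm -[(4 * _ * _)%N]mulnA -[((4 * _) %% 3)%N]modnMm.
rewrite -[((r ^ 2 * _) %% 3)%N]modnMm !sqr_mod3 r3.
by case: (3 %| x)%N; case: (3 %| y)%N.
Qed.

Lemma gser_coef0 (T : choiceType) (P : pred T) w k :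
  (forall x, P x -> w x <> k) -> gser P w k = 0.
Proof.
move=> Pk; apply: fsbig1 => x /= wx; case Px: (P x) => //.
by case: (Pk x Px).
Qed.

Lemma gser_sum (T : choiceType) n (P : 'I_n -> pred T) (R : pred T) w : proper_weight w ->
    (forall x j, P j x -> R x) -> (forall x, R x -> exists j, P j x) ->
    (forall x j j', P j x -> P j' x -> j = j') ->
  \sum_(j < n) gser (P j) w = gser R w.
Proof.
move=> pw PR RP Pinj; apply/fpsP => k; rewrite fps_coef_sum.
have [s us sP] := proper_uniq k pw.
have sP' x : w x = k -> x \in s by move=> wx; rewrite sP ?wx.
rewrite (gserE _ us) //; under eq_bigr do rewrite (gserE _ us) //.
rewrite exchange_big; apply: eq_bigr => x _ /=.
have [/RP[j Pj]|nR] := boolP (R x).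
  rewrite (bigD1 j) //= Pj big1 ?addr0 // => j' /eqP jj'.
  by case Pj': (P j' x) => //; case: jj'; exact: Pinj Pj' Pj.
by rewrite big1 // => j _; case Pj: (P j x) => //; rewrite (PR _ _ Pj) in nR.
Qed.

(** As 2 b0 = 0 modulo 2q, the class is stable under b -> -b; the projection forces b to be prime to
    3, hence nonzero, so there is no fixed point. *)
Lemma gauss_series_cancel (q : nat) (a0 b0 : int) : (q%:Z %| b0)%Z ->
  p32 (gser (gauss_pred q a0 b0) (norm_weight 1)) = 0.
Proof.
move=> /dvdzP[c bE]; rewrite p32_gser.
apply: (@gser_cancel _ (fun p => (p.1, - p.2)) (fun p => 0 < p.2)).
- exact: proper_norm_weight.
- by move=> [a b] /=; rewrite opprK.
move=> [a b] /andP[/and3P[/= a0' oa dvd]]; rewrite /norm_weight /= abszN quad_form_mod3 //.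
move=> /andP[a3 b3]; split=> //.
  rewrite a3 b3 /gauss_pred /= a0' oa /= andbT.
  have -> : a0 * - b - b0 * a = - (a0 * b - b0 * a) - c * a * (2 * q)%N%:Z.
    by rewrite bE PoszM; ring.
  by rewrite rpredB ?rpredN // dvdz_mull.
have : b != 0 by apply: contraNneq b3 => ->.
by clear; lia.
Qed.

Lemma Posz_exp2 n : (2 ^ n)%N%:Z = 2 ^+ n.
Proof. by rewrite -natz natrX. Qed.

Lemma odd_residue m (a : int) : oddz a -> exists j : 'I_(2 ^ m),
  (exists x, a = (2 * j%:Z + 1) + x * 2 ^+ m.+2) \/ (exists x, - a = (2 * j%:Z + 1) + x * 2 ^+ m.+2).
Proof.
case/oddzP => b ->; pose t : int := 2 ^+ m.
have tE : (2 ^ m)%N%:Z = t by exact: Posz_exp2.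
have t0 : 0 < t by rewrite exprn_gt0.
have -> : 2 ^+ m.+2 = 4 * t by rewrite !exprS /t; ring.
pose e := (b %% (2 * t))%Z; pose k := (b %/ (2 * t))%Z.
have bE : b = k * (2 * t) + e by exact: divz_eq.
have e0 : 0 <= e by rewrite modz_ge0 // mulf_neq0 // gt_eqF.
have e1 : e < 2 * t by rewrite ltz_pmod // pmulr_lgt0.
have [et|et] := ltP e t.
  have lt : (`|e| < 2 ^ m)%N by rewrite -ltz_nat tE gez0_abs.
  exists (Ordinal lt); left; exists k; rewrite /= gez0_abs // [b in LHS]bE; ring.
(* -(2e + 1) = 2(2t - 1 - e) + 1 modulo 4t. *)
have f0 : 0 <= 2 * t - 1 - e by move: e1; clear; lia.
have lt : (absz (2 * t - 1 - e)%R < 2 ^ m)%N.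
  by rewrite -ltz_nat tE gez0_abs //; move: et; clear; lia.
exists (Ordinal lt); right; exists (- k - 1); rewrite /= gez0_abs // [b in LHS]bE; ring.
Qed.

(** Since a0 is odd, 2^i divides b. For b = 2^i l the class condition becomes l = kap a modulo
    2^(m+2), with kap = u/a0, and the norm a^2 + 4^(i+1) l^2 explains the exponent 4^(i+1). *)
Lemma gauss_series_dsum m i (a0 b0 u kap : int) : oddz a0 -> oddz kap ->
    b0 = 2 ^+ i * u -> (2 ^+ m.+2 %| kap * a0 - u)%Z ->
  p32 (gser (gauss_pred (2 ^ (m + i.+1)) a0 b0) (norm_weight 1)) = dsum m (4 ^ i.+1) kap.
Proof.
move=> oa0 okap bE kapE; rewrite p32_gser /dsum.
pose w (p : int * int) := (1 * `|p.1| ^ 2 + 2 ^ (2 * i.+1) * (1 * `|p.2| ^ 2))%N.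
have pw1 : proper_weight (fun n : int => 1 * `|n| ^ 2)%N by exact: proper_quad.
have pw2 : proper_weight (fun n : int => 2 ^ (2 * i.+1) * (1 * `|n| ^ 2))%N.
  by apply: proper_mulw => //; rewrite expn_gt0.
have pw : proper_weight w by exact: proper_pair pw1 pw2.
pose rho (j : 'I_(2 ^ m)) : int := 2 * j%:Z + 1.
pose P (j : 'I_(2 ^ m)) (p : int * int) := theta_cls is_3unit m.+2 (rho j) p.1 &&
  theta_cls is_3unit m.+2 (kap * rho j) p.2.
pose M : int := 2 ^+ m.+2.
have jM (j : 'I_(2 ^ m)) : 0 < rho j /\ 2 * rho j < M.
  have := ltn_ord j; have := Posz_exp2 m.
  by rewrite /rho /M !exprS; clear; lia.
have M0 : 0 < M by rewrite exprn_gt0.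
have rho_nat j : rho j = (2 * j + 1)%N%:Z by rewrite PoszD PoszM.
have Pj p j j' : P j p -> P j' p -> j = j'.
  move=> /andP[/andP[/dvdz_subP[x xE] _] _] /andP[/andP[/dvdz_subP[y yE] _] _].
  have jj : (2 * j + 1 = 2 * j' + 1)%N.
    apply: (@small_residue_eq M) => //; try by rewrite -ltz_nat -rho_nat; have := jM j; have := jM j'; clear -M0; lia.
    rewrite -!rho_nat; apply/dvdz_subP; exists (y - x).
    have -> : rho j = p.1 - x * M by rewrite xE; ring.
    by rewrite yE; ring.
  by apply/val_inj => /=; move: jj; clear; lia.
pose R p := [exists j, P j p].
have -> : \sum_(j < 2 ^ m) dser m.+2 (2 * j%:Z + 1) *
    dser m.+2 (kap * (2 * j%:Z + 1)) ^+ (4 ^ i.+1) = gser R w.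
  rewrite -(@gser_sum _ _ P R w pw) => [|p j Pjp|p /existsP//|//]; last by apply/existsP; exists j.
  apply: eq_bigr => j _; rewrite -[4%N]/(2 ^ 2)%N -expnM {2}/dser /theta_ser gser_pow2 //.
  by rewrite /dser /theta_ser gserM.
have oddrho p j : P j p -> oddz p.1 /\ p.1 <> 0.
  move=> /andP[/andP[/dvdz_subP[x ->] _] _].
  have o : oddz (rho j + x * 2 ^+ m.+2).
    by apply/oddzP; exists (j%:Z + x * 2 ^+ m.+1); rewrite /rho !exprS; ring.
  by split=> // o0; rewrite o0 in o.
have dvdE (a l : int) : ((2 * 2 ^ (m + i.+1))%N%:Z %| a0 * (2 ^+ i * l) - b0 * a)%Z =
    (M %| a0 * l - u * a)%Z.
  have -> : (2 * 2 ^ (m + i.+1))%N%:Z = 2 ^+ i * M.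
    by rewrite PoszM Posz_exp2 addnS exprS exprD /M !exprS; ring.
  have -> : a0 * (2 ^+ i * l) - b0 * a = 2 ^+ i * (a0 * l - u * a) by rewrite bE; ring.
  by rewrite dvdz_mul2l // two_exp_neq0.
have kapP (a l : int) : (M %| a0 * l - u * a)%Z = (M %| l - kap * a)%Z.
  have -> : a0 * l - u * a = a0 * (l - kap * a) + a * (kap * a0 - u) by ring.
  have dv : (M %| a * (kap * a0 - u))%Z by rewrite dvdz_mull.
  rewrite (rpredDr _ dv) Gauss_dvdzr // coprimezE /M abszX coprimeXl //.
  by rewrite coprime2n.
have abs2 (l : int) : absz (2 ^+ i * l) = (2 ^ i * `|l|)%N by rewrite abszM abszX.
have three2 n : ~~ (3 %| 2 ^ n)%N by rewrite Euclid_dvdX // negb_and.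
have unit3 (l : int) : ~~ (3 %| absz (2 ^+ i * l)%R)%N = is_3unit l.
  by rewrite abs2 Euclid_dvdM // negb_or three2.
have wE (n l : int) : norm_weight 1 (n, 2 ^+ i * l) = w (n, l).
  rewrite /norm_weight /w /= abs2 expnMn !mul1n !mulnA; congr (_ + _ * _)%N.
  by congr (_ * _)%N; rewrite !muln1 -mulnA mulnS expnD mul2n -addnn expnD.
have wN (n l : int) : norm_weight 1 (- n, - l) = norm_weight 1 (n, l).
  by rewrite /norm_weight /= !abszN.
(* [dsum] fixes signs by the residue of a, the ideals by a > 0; f passes from one choice to the
   other. *)
pose f (p : int * int) := if 0 < p.1 then (p.1, 2 ^+ i * p.2) else (- p.1, - (2 ^+ i * p.2)).
have gpN (n l : int) : (0 < - n) -> oddz n -> ((2 * 2 ^ (m + i.+1))%N%:Z %| a0 * l - b0 * n)%Z ->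
    gauss_pred (2 ^ (m + i.+1)) a0 b0 (- n, - l).
  move=> n0 on dv; apply/and3P; split=> //=; first by rewrite /oddz abszN.
  by rewrite -rpredN; move: dv; congr (_ %| _)%Z; ring.
apply/esym; apply: (@gser_bij _ _ f) => //.
- exact: proper_norm_weight.
- move=> [n l] /existsP[j Pjp]; have [/= on n0] := oddrho _ _ Pjp.
  case/andP: Pjp => /andP[/dvdz_subP[x /= xE] n3] /andP[/dvdz_subP[y /= yE] l3].
  have dv : (M %| a0 * l - u * n)%Z.
    by rewrite kapP; apply/dvdz_subP; exists (y - kap * x); rewrite xE yE; ring.
  have m3 : (norm_weight 1 (n, 2 ^+ i * l)%R %% 3 == 2)%N.
    by rewrite /norm_weight quad_form_mod3 // unit3 l3 andbT.
  rewrite /f /=; case: ltP => [npos|nneg]; first by rewrite m3 wE /gauss_pred /= npos on dvdE dv.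
  rewrite wN m3 wE andbT; split=> //; apply: gpN => //; last by rewrite dvdE.
  by move: n0 nneg; clear; lia.
- move=> [a b] /andP[/and3P[/= apos oa dv]]; rewrite /norm_weight quad_form_mod3 //= => /andP[a3 b3].
  have {}a3 : is_3unit a by [].
  have [l bE'] : exists l, b = 2 ^+ i * l.
    suff /dvdzP[l ->] : (2 ^+ i %| b)%Z by exists l; rewrite mulrC.
    rewrite -(@Gauss_dvdzr _ a0); last first.
      rewrite coprimezE abszX; case: (i) => [|i']; first by rewrite expn0 coprime1n.
      by rewrite coprimeXl // coprime2n.
    have -> : a0 * b = (a0 * b - b0 * a) + 2 ^+ i * (u * a) by rewrite bE; ring.
    rewrite rpredD ?dvdz_mulr //; apply: dvdz_trans dv.
    by rewrite PoszM Posz_exp2 dvdz_mull // dvdz_exp2l // addnS -addSn leq_addl.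
  move: dv b3; rewrite bE' unit3 dvdE kapP => /dvdz_subP[y yE] l3.
  have [j [[x xE]|[x xE]]] : exists j, (exists x, a = rho j + x * M) \/ (exists x, - a = rho j + x * M).
    exact: odd_residue.
  + exists (a, l); last by rewrite /f /= apos.
    apply/existsP; exists j; rewrite /P /theta_cls /= a3 l3 !andbT.
    apply/andP; split; apply/dvdz_subP; first by exists x.
    by exists (y + kap * x); rewrite yE [X in kap * X + _]xE; ring.
  + exists (- a, - l); last first.
      by rewrite /f /= oppr_gt0 ltNge ltW //= mulrN !opprK.
    apply/existsP; exists j; rewrite /P /theta_cls /= !is_3unitN l3 a3 !andbT.
    apply/andP; split; apply/dvdz_subP; first by exists x.
    exists (- y + kap * x); have -> : - l = kap * - a - y * M by rewrite yE; ring.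
    by rewrite xE; ring.
- move=> [n l] [n' l'] /existsP[j Pj1] /existsP[j' Pj2]; rewrite /f /=.
  have inj2 (x y : int) : 2 ^+ i * x = 2 ^+ i * y -> x = y by apply: mulfI; exact: two_exp_neq0.
  (* Otherwise M would divide rho j + rho j', which lies strictly between 0 and M. *)
  have nn : n <> - n'.
    case/andP: Pj1 => /andP[/dvdz_subP[x /= xE] _] _.
    case/andP: Pj2 => /andP[/dvdz_subP[y /= yE] _] _.
    move=> nn; have rr : rho j + rho j' = - (x + y) * M.
      have -> : rho j = n - x * M by rewrite xE; ring.
      have -> : rho j' = n' - y * M by rewrite yE; ring.
      by rewrite nn; ring.
    have [r0 r1] := jM j; have [r0' r1'] := jM j'.
    have : 0 < - (x + y) * M by rewrite -rr addr_gt0.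
    have : - (x + y) * M < 1 * M by rewrite mul1r -rr; move: r1 r1'; clear; lia.
    by rewrite ltr_pM2r // pmulr_lgt0 //; clear; lia.
  case: ltP => h1; case: ltP => h2 [nE lE].
  + by rewrite nE (inj2 _ _ lE).
  + by case: nn.
  + by case: nn; rewrite -nE opprK.
  + by rewrite (oppr_inj nE) (inj2 _ _ (oppr_inj lE)).
Qed.

(** * The half series of AMB *)

Lemma card_weight_count (T : choiceType) (P : pred T) w k (s : seq T) : uniq s ->
    (forall x, (w x <= k)%N -> x \in s) ->
  #|` fset_set [set x | P x /\ w x = k]|%fset = count (fun x => P x && (w x == k)) s.
Proof.
move=> us sP; rewrite -size_filter; apply: card_set_seq => [|x]; first exact: filter_uniq.
rewrite mem_filter; split=> [[Px wx]|/andP[/andP[Px /eqP wx] _]] //.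
by rewrite Px wx eqxx sP ?wx.
Qed.

Definition amb_pred (p : int * int) : bool := [&& 0 < p.1, oddz p.1 & oddz p.2].

Lemma AMB_generators q I : AMB q I <->
  exists p, amb_pred p /\ I = principal (Gint p.1 (2 * (p.2 * q%:Z))).
Proof.
split=> [[a [b [oa ob ->]]]|[[a b] [/and3P[/= a0 oa ob] ->]]]; last by exists a, b; rewrite mulrA.
have [a0|a0] := ltP 0 a; first by exists (a, b); rewrite /amb_pred /= a0 oa ob mulrA.
have na : 0 < - a by move: oa a0; rewrite /oddz; clear; lia.
exists (- a, - b); split; first by move: oa ob; rewrite /amb_pred /oddz /= !abszN na => -> ->.
by rewrite -principal_opp; congr (principal (Gint _ _)) => /=; ring.
Qed.

(** Since b is odd, b -> -b pairs the ideals without fixed points; one half counts those with b >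
    0. *)
Lemma red2_half_theta_AMB q : (0 < q)%N -> red2 (half_fps (theta (AMB q))) =
  gser (fun p => amb_pred p && (0 < p.2)) (norm_weight q).
Proof.
move=> q0; apply/fpsP => n; have pw := proper_norm_weight q0; rewrite gser_card //.
have [s us sP] := proper_uniq n pw.
rewrite -[LHS]/((theta (AMB q) n %/ 2)%Z%:~R).
rewrite (theta_card n q0 (@AMB_generators q)); last by move=> p /and3P[].
set c := #|` fset_set [set p | (amb_pred p && _) /\ _]|%fset.
have -> : #|` fset_set [set p | amb_pred p /\ norm_weight q p = n]|%fset = (c + c)%N.
  rewrite (card_weight_count amb_pred us sP).
  have -> : count (fun x => amb_pred x && (norm_weight q x == n)) s =
    (count (fun x => (amb_pred x && (0 < x.2)%R) && (norm_weight q x == n)) s +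
     count (fun x => (amb_pred x && ~~ (0 < x.2)%R) && (norm_weight q x == n)) s)%N.
    by elim: (s) => //= x s' ->; case: (amb_pred x); case: (0 < x.2); case: (_ == n) => /=; lia.
  rewrite -!(card_weight_count _ us sP) -/c; congr (_ + _)%N.
  apply: (@card_set_bij _ _ (fun p => (p.1, - p.2))).
  - by apply: (sub_finite_set _ (finite_fiber n pw)) => p [].
  - move=> [a b] [/= /andP[/and3P[/= a0 oa ob] b0] wn]; split.
      apply/andP; split; last by rewrite /= oppr_gt0 -leNgt ltW.
      by apply/and3P; split=> //; rewrite /oddz abszN.
    by rewrite -wn /norm_weight /= abszN.
  - move=> [a b] [/= /andP[/and3P[/= a0 oa ob] b0] wn]; exists (a, - b); last by rewrite /= opprK.
    split; last by rewrite -wn /norm_weight /= abszN.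
    apply/andP; split; first by apply/and3P; split=> //; rewrite /oddz abszN.
    by move: ob b0; rewrite /oddz /=; lia.
  - by move=> [a b] [a' b'] _ _ [-> /oppr_inj ->].
by rewrite addnn -muln2 PoszM mulzK // -pmulrn.
Qed.

(** After projection a and b run independently over the positive integers prime to 6, and the norm
    a^2 + 4q^2 b^2 yields D times D^(4q^2). *)
Lemma p32_half_AMB k : p32 (red2 (half_fps (theta (AMB (2 ^ k))))) = D ^+ (2 ^ (2 * k.+1)).+1.
Proof.
have q0 : (0 < 2 ^ k)%N by rewrite expn_gt0.
have pn := proper_nat_sqr.
have pn2 : proper_weight (fun m : nat => 2 ^ (2 * k.+1) * m ^ 2)%N.
  by apply: proper_mulw => //; rewrite expn_gt0.
rewrite red2_half_theta_AMB // p32_gser exprS D_gser_nat gser_pow2 // gserM //.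
have three2 : ~~ (3 %| 2 ^ k)%N by rewrite Euclid_dvdX // negb_and.
apply/esym; apply: (@gser_bij _ _ (fun p : nat * nat => (p.1%:Z, p.2%:Z))).
- exact: (proper_pair pn pn2).
- exact: proper_norm_weight.
- move=> [a b] /andP[/= /andP[a0 a6] /andP[b0 b6]]; move: a6 b6; rewrite !coprime_nat6.
  move=> /andP[oa a3] /andP[ob b3]; split.
    by rewrite /amb_pred /norm_weight /= quad_form_mod3 // a3 b3 !ltz_nat a0 b0 /oddz /= oa ob.
  by rewrite /norm_weight /=; congr (_ + _ * _)%N; rewrite mulnS expnD -expnM [(k * 2)%N]mulnC.
- move=> [[a|a] [b|b]] /andP[/andP[/and3P[//= a0 oa ob] //= b0]].
  rewrite /norm_weight quad_form_mod3 //= => /andP[a3 b3]; exists (a, b) => //=.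
  by rewrite !coprime_nat6 a3 b3 -!ltz_nat a0 b0 [odd a]oa [odd b]ob.
- by move=> [a b] [a' b'] _ _ [-> ->].
Qed.

Lemma W5_half_AMB k : W5 (2 ^ k) (p32 (red2 (half_fps (theta (AMB (2 ^ k)))))).
Proof.
rewrite p32_half_AMB; apply: span_gen; exists (2 ^ (2 * k.+1)).+1; split=> //.
  have m6 n : ((4 ^ n.+1) %% 6 = 4)%N by elim: n => // n IH; rewrite expnS -modnMmr IH.
  by rewrite expnM -addn1 -modnDml m6.
rewrite -expnM [(k * 2)%N]mulnC mulnS expnD.
by have : (0 < 2 ^ (2 * k))%N; [rewrite expn_gt0 | lia].
Qed.

Lemma W5_gauss_class k C : gauss_class (2 ^ k) C -> W5 (2 ^ k) (p32 (red2 (theta C))).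
Proof.
have p320 : p32 0 = 0 by apply/fpsP => n /=; rewrite if_same.
case/gauss_class_theta => [|->|[a0 [b0 [oa0 ->]]]]; [by exists k | by rewrite p320; exact: span0 |].
have [qb|qb] := boolP ((2 ^ k)%N%:Z %| b0)%Z; first by rewrite gauss_series_cancel //; exact: span0.
have b00 : (0 < `|b0|)%N by rewrite absz_gt0; apply: contraNneq qb => ->; exact: dvdz0.
have [i [u [ou bE]]] : exists i u, oddz u /\ b0 = 2 ^+ i * u.
  have [v cv vE] := pfactor_coprime (isT : prime 2) b00.
  exists (logn 2 `|b0|), (sgz b0 * v%:Z); split.
    have -> : oddz (sgz b0 * v%:Z) = oddz v by move: b00; rewrite /oddz; clear; case: sgzP; lia.
    by rewrite coprime2n in cv.
  by rewrite mulrCA -Posz_exp2 -PoszM [(_ * v)%N]mulnC -vE -intEsg.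
have ik : (i < k)%N.
  rewrite ltnNge; apply: contra qb => ki.
  by rewrite bE Posz_exp2 dvdz_mulr // dvdz_exp2l.
pose m := (k - i.+1)%N; have kE : k = (m + i.+1)%N by rewrite subnK.
have [kap kapE] : exists kap, (2 ^+ m.+2 %| kap * a0 - u)%Z.
  have [x [y xy]] := Bezoutz a0 (2 ^+ m.+2).
  have cop : gcdz a0 (2 ^+ m.+2) = 1.
    by apply/eqP; rewrite -[_ == _]/(coprimez _ _) coprimezE abszX coprimeXr // coprimen2.
  exists (x * u); apply/dvdz_subP; exists (- (y * u)).
  have -> : x * u * a0 = x * a0 * u by ring.
  have -> : x * a0 = 1 - y * 2 ^+ m.+2.
    by apply/eqP; rewrite -subr_eq0 opprB addrA xy cop subrr.
  by ring.
have okap : oddz kap.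
  apply: contraT => /oddzNP[v vE]; case/dvdz_subP: kapE => y; rewrite vE exprS => uE.
  have := ou; have -> : u = 2 * (v * a0 - y * 2 ^+ m.+1) by rewrite mulrBr mulrA uE; ring.
  by rewrite /oddz abszM oddM.
have dE := gauss_series_dsum oa0 okap bE kapE.
(* The norms are odd, and the projection keeps those that are 2 modulo 3, hence 5 modulo 6. *)
rewrite kE dE; apply: W5_dsum => // n n6; rewrite -dE p32_gser; apply: gser_coef0.
move=> [a b] /andP[/and3P[/= _ oa _] w3] wn; rewrite wn in w3.
have : odd n.
  by rewrite -wn /norm_weight /= -mulnA oddD oddM /= addbF oddX /=; exact: oa.
by move: n6 w3; clear; lia.
Qed.

Theorem theorem3p19 (q : nat) (hq : exists k : nat, q = (2 ^ k)%N) :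
  DI q `<=` W5 q.
Proof.
case: hq => k -> _ [_ [n [c [u [uP ->]]]] <-].
have -> : p32 (\sum_(i < n) c i *: u i) = \sum_(i < n) c i *: p32 (u i).
  apply/fpsP => j; rewrite fps_coef_sum /= fps_coef_sum; case: ifP => // _.
  by rewrite big1 // => i _; rewrite mulr0.
apply: span_sum => i _; apply: spanZ.
by case: (uP i) => [[C gC ->]|->]; [exact: W5_gauss_class | exact: W5_half_AMB].
Qed.
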